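(* Let $Z$ be a Banach space and $J:Z\to\mathbb{R}$ a functional such that: (G1) $Z=Z^+\oplus Z^-$ with $\dim(Z^-)<\infty$ and $\dim(Z^+)=\infty$; (G2) $J\in C^1(Z)$ is even with $J(0)=0$ and, for some $\rho>0$, $\inf_{S_\rho^+}J>0$ where $S_\rho^+=\{v\in Z^+:\|v\|=\rho\}$; (G3) for any given $m\in\mathbb{N}$ there is a finite-dimensional subspace $Z_m\subset Z^+$ such that $J(u)\to-\infty$ uniformly for $u\in Z^-\oplus Z_m$ as $\|u\|\to\infty$ (for each fixed $m$), and $\dim(Z_m)\nearrow+\infty$ as $m\to\infty$; (G4) $J$ is PS-attracting. Then every $\mathcal K$-decomposition of $J$ is infinite. In particular, $J$ has infinitely many pairs of critical points.
   Context: $\mathcal K:=\{u\in Z:J'(u)=0\}$ is the set of critical points of $J$. A set $A\subset Z$ is symmetric if $x\in A\iff -x\in A$. $\mathcal K$-decomposition: for an even $J\in C^1(Z)$, a $\mathcal K$-decomposition is a representation $\mathcal K=\bigcup_{i\in I}\mathcal K^i$ for some index set $I$ such that for all $i,j\in I$ (including $i=j$): (i) $\mathcal K^i$ is bounded, symmetric and non-empty; (ii) $\inf\{\|u-v\|:u,v\in\mathcal K^i\cup\mathcal K^j,\ u\neq v\}>0$; (iii) $\{J(u):u\in\mathcal K^i\}$ is a finite set. It is called finite if $\#I<\infty$ and infinite if $\#I=\infty$. PS-attracting: $J$ is PS-attracting if for any two Palais–Smale sequences $(v_n)_n,(w_n)_n$ of $J$ one either has $\|v_n-w_n\|\to0$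 as $n\to\infty$ or $\limsup_{n\to\infty}\|v_n-w_n\|\geq\kappa$, where $\kappa:=\inf\{\|u-v\|:u,v\in\mathcal K,\ u\neq v\}$ (it is not required that $\kappa>0$). A Palais–Smale sequence is a sequence $(v_n)$ in $Z$ with $J(v_n)\to c$ for some $c\in\mathbb{R}$ and $J'(v_n)\to0$. The infimum of the empty set is $+\infty$. *)

(* Defs.v *)
From HB Require Import structures.
From mathcomp Require Import all_boot all_order all_algebra.
From mathcomp Require Import all_classical all_reals all_analysis.

Set Implicit Arguments.
Unset Strict Implicit.
Unset Printing Implicit Defensive.

Import Order.TTheory GRing.Theory Num.Theory.
Import numFieldNormedType.Exports.

Local Open Scope classical_set_scope.
Local Open Scope ring_scope.

Definition is_subspace (R : realType) (Z : lmodType R) (A : set Z) : Prop :=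
  submod_closed (mem A).

Definition has_dim (R : realType) (Z : lmodType R) (A : set Z) (n : nat) : Prop :=
  exists b : 'I_n -> Z,
    (forall c : 'I_n -> R, \sum_(i < n) c i *: b i = 0 -> forall i, c i = 0) /\
    A = [set \sum_(i < n) c i *: b i | c in [set: 'I_n -> R]].

Definition finite_dim (R : realType) (Z : lmodType R) (A : set Z) : Prop :=
  exists n, has_dim A n.

Definition sum_set (Z : zmodType) (A B : set Z) : set Z :=
  [set a + b | a in A & b in B].

(* Direct sums in a Banach space are topological: both summands are closed. *)
Definition direct_sum (R : realType) (Z : normedModType R) (A B : set Z) : Prop :=
  [/\ is_subspace A, is_subspace B, closed A, closed B &
      sum_set A B = [set: Z] /\ A `&` B = [set 0]].

Section Functional.
Context (R : realType) (Z : normedModType R).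
Implicit Types (J : Z -> R) (A : set Z) (v w : nat -> Z).

(* The values are in \bar R so that no boundedness proof is needed. *)
Definition dual_norm (L : Z -> R) : \bar R :=
  ereal_sup [set (`|L h|)%:E | h in [set h : Z | `|h| <= 1]].

Definition is_C1 J : Prop :=
  (forall u, differentiable J u) /\
  (forall u, dual_norm (fun h => 'd J v h - 'd J u h) @[v --> u] --> 0%E).

Definition critical_set J : set Z := [set u | forall h, 'd J u h = 0].

Definition critical_pairs J : set (set Z) :=
  [set [set u; - u] | u in [set u | critical_set J u /\ u <> 0]].

Definition symmetric_set A : Prop := forall x, A x <-> A (- x).

(* ereal_inf set0 = +oo, so the separation of a set with at most one point
   is +oo. *)
Definition separation A : \bar R :=
  ereal_inf [set d | exists u v : Z, [/\ A u, A v, u <> v & d = (`|u - v|)%:E]].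

Definition PS_sequence J v : Prop :=
  (exists c : R, J (v n) @[n --> \oo] --> c) /\
  dual_norm ('d J (v n)) @[n --> \oo] --> 0%E.

Definition PS_attracting J : Prop :=
  forall v w, PS_sequence J v -> PS_sequence J w ->
    `|v n - w n| @[n --> \oo] --> (0 : R) \/
    (separation (critical_set J) <= limn_esup (fun n => (`|v n - w n|)%:E))%E.

Definition K_decomposition J (I : Type) (Ks : I -> set Z) : Prop :=
  critical_set J = \bigcup_(i in [set: I]) Ks i /\
  forall i j : I,
    [/\ [/\ bounded_set (Ks i), symmetric_set (Ks i) & Ks i !=set0],
        (0 < separation (Ks i `|` Ks j))%E &
        finite_set (J @` Ks i)].

End Functional.

(* Main.v *)
Require Import Defs.
From HB Require Import structures.
From mathcomp Require Import all_boot all_order all_algebra.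
From mathcomp Require Import all_classical all_reals all_analysis.
From mathcomp Require Import fingroup perm zify lra.

Set Implicit Arguments.
Unset Strict Implicit.
Unset Printing Implicit Defensive.

Import Order.TTheory GRing.Theory Num.Theory.
Import numFieldNormedType.Exports.

Local Open Scope classical_set_scope.
Local Open Scope ring_scope.

(** Suppose that the critical points are separated and that J takes only N values
    on them. For X = Z^- + Z_m with dim Z_m > N, let c_j be the infimum of the b such
    that X can be mapped into {J <= b} by an odd map fixing the points far from 0,
    after discarding a set of genus at most j.

    A Borsuk-Ulam type theorem (an odd map f : R^(n+1) -> R^n vanishes somewhere on
    {s = 0}, when s is even, negative at 0 and positive far away) applied to the
    Z^- component of the map, the j odd functions witnessing the genus, and the
    distance to the sphere of radius rho, gives c_j >= inf J(S_rho^+) > 0 for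
    j < dim Z_m. By PS-attraction the almost critical points at a level c fall
    into clusters of small diameter lying far apart, and -C is a different cluster from
    C when c > 0; so all clusters together have genus 1. Away from the clusters the
    slope of J is bounded below, and deforming there yields c_(j+1) < c_j. Inside one
    cluster the Palais-Smale condition holds, so a level c_j that is not critical
    could be lowered by deforming inside the clusters too. Hence the c_j are dim Z_m
    distinct critical values, a contradiction.

    Deformations are obtained without flows: small descending steps on a compact set are
    chained by the Brezis-Browder principle. The Borsuk-Ulam type theorem is proved by
    a mod 2 count of flags of a symmetric cubical grid. *)

(** * A combinatorial Borsuk-Ulam theorem *)

(** Every orbit of [g] on [P] has two elements with the same value of [F], so the sum cancels mod 2;
    the element of smaller rank represents its orbit. *)
Lemma addb_involution (T : finType) (P F : pred T) (g : T -> T) :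
  involutive g -> (forall x, P x -> g x != x) ->
  (forall x, P x -> P (g x)) -> (forall x, P x -> F (g x) = F x) ->
  \big[addb/false]_(x | P x) F x = false.
Proof.
move=> gK gN gP gF.
rewrite (bigID (fun x => enum_rank x < enum_rank (g x))%N) /=.
rewrite [X in _ (+) X](reindex_inj (inv_inj gK)) /=.
rewrite [X in _ (+) X](eq_bigl (fun x => P x && (enum_rank x < enum_rank (g x))%N)); last first.
  move=> x /=; have -> : P (g x) = P x.
    by apply/idP/idP => [/gP|/gP //]; rewrite gK.
  case Px : (P x) => //=; rewrite gK -leqNgt leq_eqVlt.
  case: eqP => // /val_inj /enum_rank_inj e.
  by move: (gN _ Px); rewrite -e eqxx.
rewrite [X in _ (+) X](eq_bigr F) ?addbb // => x /andP[Px _]; exact: gF.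
Qed.

Section LexSign.
Variable n : nat.
Implicit Types p : {ffun 'I_n -> int}.

(** The sign of the first nonzero coordinate: an antisymmetric labelling of the nonzero points,
    imposed on all labels near 0. *)
Definition lexpos p :=
  [exists i, (0 < p i) && [forall j : 'I_n, (j < i)%N ==> (p j == 0)]].

Lemma first_nonzero p : p != 0 ->
  exists2 i, p i != 0 & forall j : 'I_n, (j < i)%N -> p j = 0.
Proof.
move=> p0; have /existsP[i0 i0P] : [exists i, p i != 0].
  apply: contraNT p0; rewrite negb_exists => /forallP H.
  by apply/eqP/ffunP => i; rewrite ffunE; move: (H i); rewrite negbK => /eqP.
case: (@arg_minnP _ i0 (fun i => p i != 0) (fun i => i : nat) i0P) => i pi mi.
exists i => // j ji; apply/eqP; apply: contraTT ji => /mi.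
by rewrite -leqNgt.
Qed.

Lemma lexposE p (i : 'I_n) : p i != 0 -> (forall j : 'I_n, (j < i)%N -> p j = 0) ->
  lexpos p = (0 < p i).
Proof.
move=> pi H; apply/existsP/idP => [[k /andP[pk /forallP Hk]]|pi0].
  have [ki|ik|e] := ltngtP k i.
  - by move: pk; rewrite H // ltxx.
  - by move: (Hk i); rewrite ik /= (negbTE pi).
  - by rewrite -(val_inj e).
exists i; rewrite pi0; apply/forallP => j; apply/implyP => /H ->; exact: eqxx.
Qed.

Lemma lexposN p : p != 0 -> lexpos (- p) = ~~ lexpos p.
Proof.
move=> /first_nonzero[i pi H].
rewrite (lexposE pi H) (@lexposE (- p) i) ?ffunE ?oppr_eq0 //.
  by rewrite oppr_gt0 -leNgt le_eqVlt (negbTE pi).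
by move=> j /H pj; rewrite ffunE pj oppr0.
Qed.

Lemma lexpos0 : lexpos 0 = false.
Proof. by apply/negbTE/existsPn => i; rewrite ffunE ltxx. Qed.

Lemma lexpos_neq0 p : lexpos p -> p != 0.
Proof. by apply: contraTneq => ->; rewrite lexpos0. Qed.

Lemma eq_lexpos p p' (i : 'I_n) : p i != 0 ->
  (forall j : 'I_n, (j <= i)%N -> p' j = p j) -> lexpos p' = lexpos p.
Proof.
move=> pi H.
have [|k pk Hk] := @first_nonzero p.
  by apply: contraNneq pi => ->; rewrite ffunE.
have ki : (k <= i)%N.
  by rewrite leqNgt; apply/negP => /Hk pi0; rewrite pi0 eqxx in pi.
rewrite (lexposE pk Hk) (@lexposE p' k) ?H //.
by move=> j jk; rewrite H ?Hk // (leq_trans (ltnW jk)).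
Qed.

End LexSign.

Section Flags.
Variables n m : nat.
Local Notation point := {ffun 'I_n.+1 -> int}.
Local Notation cube := {ffun 'I_n.+1 -> 'I_m.*2}.
Local Notation flag := (cube * {perm 'I_n.+1} * {ffun 'I_n.+1 -> bool})%type.
Implicit Types (q : cube) (s : flag) (r : {perm 'I_n.+1}) (j k : nat).

(* Cubes are indexed by their centres, whose coordinates are the odd integers
   of absolute value < 2 m; points with some even coordinates are the centres
   of their faces. *)
Definition oddz (x : 'I_m.*2) : int := (x.*2.+1)%:Z - (m.*2)%:Z.
Definition center q : point := [ffun i => oddz (q i)].
Definition sgz_bool (b : bool) : int := if b then 1 else -1.

(* A maximal flag of the barycentric subdivision: in its top cube q, the face
   vtx j has made the coordinates of rank >= j even, in the directions t. *)
Definition vtx s j : point :=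
  [ffun i => oddz (s.1.1 i) + (if (j <= s.1.2 i)%N then sgz_bool (s.2 i) else 0)].

Definition opp_cube q : cube := [ffun i => rev_ord (q i)].
Definition opp_flag s : flag := (opp_cube s.1.1, s.1.2, [ffun i => ~~ s.2 i]).
(** The adjacent flags: [swap_flag k], [flip_flag] and [top_flag] change only the vertex number
    [k.+1], 0 and [n.+1] respectively. [top_flag] passes to a neighbouring cube; coordinates move
    cyclically so that it is an involution even at the border, where the cube reached is not a true
    neighbour. *)
Definition swap_flag k s : flag :=
  (s.1.1, (s.1.2 * tperm (inord k) (inord k.+1))%g, s.2).
Definition flip_flag s : flag :=
  (s.1.1, s.1.2, [ffun i => (s.1.2 i == ord0) (+) s.2 i]).
Definition move_coord (b : bool) (x : 'I_m.*2) : 'I_m.*2 :=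
  if b then ordS x else ord_pred x.
Definition top_flag s : flag :=
  ([ffun i => if s.1.2 i == ord_max then move_coord (s.2 i) (s.1.1 i) else s.1.1 i],
   s.1.2, [ffun i => (s.1.2 i == ord_max) (+) s.2 i]).

Lemma oddzN x : oddz (rev_ord x) = - oddz x.
Proof. rewrite /oddz /=; have := ltn_ord x; lia. Qed.

Lemma oddz_neq0 x : oddz x != 0.
Proof. rewrite /oddz; lia. Qed.

Lemma oddz_inj : injective oddz.
Proof. by move=> x y; rewrite /oddz => h; apply: val_inj => /=; lia. Qed.

Lemma center_opp q : center (opp_cube q) = - center q.
Proof. by apply/ffunP => i; rewrite !ffunE oddzN. Qed.

Lemma opp_cubeK : involutive opp_cube.
Proof. by move=> q; apply/ffunP => i; rewrite !ffunE rev_ordK. Qed.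

Lemma opp_flagK : involutive opp_flag.
Proof.
move=> [[q r] t]; rewrite /opp_flag /= opp_cubeK; congr (_, _, _).
by apply/ffunP => i; rewrite !ffunE negbK.
Qed.

Lemma opp_flag_neq s : opp_flag s != s.
Proof.
apply/eqP => /(congr1 snd) /= /ffunP /(_ ord0).
by rewrite /opp_flag /= ffunE; case: (s.2 ord0).
Qed.

Lemma vtx_opp s j : vtx (opp_flag s) j = - vtx s j.
Proof.
apply/ffunP => i; rewrite !ffunE /= ?ffunE oddzN.
by case: leqP => _; case: (s.2 i) => /=; rewrite ?addr0 ?oppr0 ?opprD ?opprK.

Qed.

Lemma swap_flagK k : involutive (swap_flag k).
Proof. by move=> [[q r] t]; rewrite /swap_flag /= -mulgA tperm2 mulg1. Qed.

Lemma swap_flag_neq k s : (k < n)%N -> swap_flag k s != s.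
Proof.
move=> kn; apply/eqP => /(congr1 (fun s => s.1.2)) /permP.
move=> /(_ ((s.1.2)^-1 (inord k))%g) /=.
rewrite permM permKV tpermL => /(congr1 val) /=.
by rewrite !inordK //; lia.
Qed.

Lemma vtx_swap k s j : (k < n)%N -> j != k.+1 -> vtx (swap_flag k s) j = vtx s j.
Proof.
move=> kn jk; apply/ffunP => i; rewrite !ffunE /= permM.
congr (_ + _); have -> // : (j <= tperm (inord k) (inord k.+1) (s.1.2 i))%N = (j <= s.1.2 i)%N.
by case: tpermP => [->|->|//]; rewrite !inordK; lia.
Qed.

Lemma flip_flagK : involutive flip_flag.
Proof.
move=> [[q r] t]; rewrite /flip_flag /=; congr (_, _, _).
by apply/ffunP => i; rewrite !ffunE /= addbA addbb.
Qed.

Lemma flip_flag_neq s : flip_flag s != s.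
Proof.
apply/eqP => /(congr1 snd) /= /ffunP /(_ ((s.1.2)^-1 ord0)%g).
by rewrite /flip_flag /top_flag /= ffunE permKV eqxx; case: (s.2 _).
Qed.

Lemma vtx_flip s j : vtx (flip_flag s) j.+1 = vtx s j.+1.
Proof.
apply/ffunP => i; rewrite !ffunE /= ?ffunE; case: leqP => //.
by case: eqP => [->|].
Qed.

Lemma top_flagK : involutive top_flag.
Proof.
move=> [[q r] t]; rewrite /top_flag /=; congr (_, _, _); apply/ffunP => i;
  rewrite !ffunE /=; last by rewrite addbA addbb.
by case: eqP => //= _; rewrite /move_coord; case: (t i); rewrite /= ?ordSK ?ord_predK.
Qed.

Lemma top_flag_neq s : top_flag s != s.
Proof.
apply/eqP => /(congr1 snd) /= /ffunP /(_ ((s.1.2)^-1 ord_max)%g).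
by rewrite /flip_flag /top_flag /= ffunE permKV eqxx; case: (s.2 _).
Qed.

Definition inner_cube q := [forall i, (0 < q i < m.*2.-1)%N].

Lemma oddz_move b (x : 'I_m.*2) : (0 < x < m.*2.-1)%N ->
  oddz (move_coord b x) = oddz x + (sgz_bool b) *+ 2.
Proof.
move=> hx; rewrite /oddz /move_coord; case: b => /=.
  rewrite modn_small; lia.
have -> : (x + m.*2).-1 = (x.-1 + m.*2)%N by lia.
by rewrite modnDr modn_small; lia.
Qed.

Lemma vtx_top s j : inner_cube s.1.1 -> (j <= n)%N -> vtx (top_flag s) j = vtx s j.
Proof.
move=> /forallP qi jn; apply/ffunP => i; rewrite !ffunE /= ?ffunE.
case: eqP => //= ->; rewrite jn oddz_move //.
by case: (s.2 i) => /=; lia.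
Qed.

Lemma vtx_neq0 s j : vtx s j.+1 != 0.
Proof.
apply/eqP => /ffunP /(_ ((s.1.2)^-1 ord0)%g).
by rewrite !ffunE permKV /= addr0 => /eqP; rewrite (negbTE (oddz_neq0 _)).
Qed.

End Flags.

(** Induction gives [i <= f i]; the same bound for the map conjugated by [rev_ord] gives the
    converse inequality. *)
Lemma incr_ord_id n (f : 'I_n -> 'I_n) :
  (forall i j : 'I_n, (i < j)%N -> (f i < f j)%N) -> forall i, f i = i.
Proof.
have ge (g : 'I_n -> 'I_n) : (forall i j : 'I_n, (i < j)%N -> (g i < g j)%N) ->
    forall k (i : 'I_n), i = k :> nat -> (k <= g i)%N.
  move=> gi; elim=> // k IH i ik.
  have kn : (k < n)%N by rewrite ltnW // -ik.
  apply: leq_ltn_trans (IH (Ordinal kn) erefl) _.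
  by apply: gi; rewrite ik /=.
move=> fi i; apply/val_inj/eqP; rewrite eqn_leq; apply/andP; split; last first.
  exact: (ge f).
have := ge (fun i => rev_ord (f (rev_ord i))) _ (rev_ord i) (rev_ord i) erefl.
rewrite rev_ordK /= => H.
have {}H : (n - i.+1 <= n - (f i).+1)%N.
  by apply: H => j k jk /=; have := fi (rev_ord k) (rev_ord j);
    have := ltn_ord j; have := ltn_ord k; rewrite /=;
    have := ltn_ord (f (rev_ord k)); have := ltn_ord (f (rev_ord j)); lia.
have := ltn_ord i; have := ltn_ord (f i); lia.
Qed.

Lemma addb_inj_false a b : a (+) b = false -> a = b.
Proof. by case: a; case: b. Qed.

Section Parity.
Variables (n m : nat) (m_gt0 : (0 < m)%N).
Local Notation point := {ffun 'I_n.+1 -> int}.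
Local Notation cube := {ffun 'I_n.+1 -> 'I_m.*2}.
Local Notation flag := (cube * {perm 'I_n.+1} * {ffun 'I_n.+1 -> bool})%type.
Implicit Types (s : flag).
(** [eps] gives n antisymmetric labels, all equal to the lexicographic sign next to 0. [C] is a
    symmetric region made of cubes; it contains the cubes touching 0 and avoids the border of the
    grid. *)
Variables (eps : 'I_n -> point -> bool) (C : pred cube).
Hypothesis eps_opp : forall i (p : point), p != 0 -> eps i (- p) = ~~ eps i p.
Hypothesis eps_lex : forall i (p : point), p != 0 -> (forall j, `|p j| <= 1) -> eps i p = lexpos p.
Hypothesis C_opp : forall q, C (opp_cube q) = C q.
Hypothesis C_inner : forall q, C q -> inner_cube q.
Hypothesis C_center : forall q, (forall i, `|center q i| <= 1) -> C q.

(* Cup product of the 1-cocycles "eps i changes sign", on the face of the flag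
   s obtained by deleting vtx s k. *)
Definition sign_changes k (s : flag) :=
  [forall i : 'I_n, if (i < k)%N then eps i (vtx s i) != eps i (vtx s i.+1)
                    else eps i (vtx s i.+1) != eps i (vtx s i.+2)].

Lemma forallD1 (k : 'I_n) (F : pred 'I_n) :
  [forall i, F i] = [forall i, (i != k) ==> F i] && F k.
Proof.
apply/forallP/andP => [H|[/forallP H Fk] i].
  by split=> //; apply/forallP => i; rewrite H implybT.
by move: (H i); case: eqP => [->|].
Qed.

(** The two products differ only in factor k, and a change from k to k+1 plus a change from k+1 to
    k+2 is, mod 2, a change from k to k+2. *)
Lemma sign_changesS (k : 'I_n) s : sign_changes k.+1 s (+) sign_changes k s =
  [forall i : 'I_n, (i != k) ==>
     if (i < k)%N then eps i (vtx s i) != eps i (vtx s i.+1)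
     else eps i (vtx s i.+1) != eps i (vtx s i.+2)] &&
  (eps k (vtx s k) != eps k (vtx s k.+2)).
Proof.
rewrite /sign_changes (forallD1 k) [X in _ (+) X](forallD1 k) ltnSn ltnn.
set X := [forall i, _]; set Y := [forall i, _].
have -> : X = Y.
  apply: eq_forallb => i; case: eqP => //= /eqP ik.
  by rewrite ltnS leq_eqVlt val_eqE (negbTE ik).
by case: Y => //=; do 3 case: (eps k _).
Qed.

(* The cocycle condition leaves a term not involving vtx k.+1, the only face
   changed by swap_flag k. *)
Lemma sum_sign_changesS k : (k < n)%N ->
  \big[addb/false]_(s | C s.1.1 && lexpos (vtx s 0)) sign_changes k.+1 s =
  \big[addb/false]_(s | C s.1.1 && lexpos (vtx s 0)) sign_changes k s.
Proof.
move=> kn; apply: addb_inj_false.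
rewrite -big_split /=; apply: (addb_involution (@swap_flagK n m k)) => s Ps.
- exact: swap_flag_neq.
- by rewrite vtx_swap.
- rewrite (sign_changesS (Ordinal kn)) (sign_changesS (Ordinal kn)) /=.
  congr (_ && _); last by rewrite !vtx_swap //; lia.
  apply: eq_forallb => i; case: eqP => //= /eqP; rewrite -val_eqE /= => ik.
  by case: ltnP => ?; rewrite !vtx_swap //; lia.
Qed.

Lemma sign_changes_opp s : sign_changes 0 (opp_flag s) = sign_changes 0 s.
Proof.
apply: eq_forallb => i; rewrite /= ?ltn0 !vtx_opp !eps_opp ?vtx_neq0 //.
by do 2 case: (eps i _).
Qed.


Lemma ltn_double : (m < m.*2)%N. Proof. lia. Qed.
Definition mid := Ordinal ltn_double.
(** Coordinates become odd from the last to the first, with alternating signs, so each new vertex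
    has a new first nonzero coordinate and the opposite lexicographic sign. *)
Definition zigzag : flag :=
  ([ffun i : 'I_n.+1 => if odd i then rev_ord mid else mid], perm (@rev_ord_inj _),
   [ffun i : 'I_n.+1 => odd i]).

Lemma oddz_mid : oddz mid = 1. Proof. rewrite /oddz /=; lia. Qed.

Lemma oddz_zigzag i : oddz (zigzag.1.1 i) = if odd i then -1 else 1.
Proof. by rewrite ffunE; case: odd; rewrite ?oddzN oddz_mid. Qed.

Lemma zigzag_vtx0 : vtx zigzag 0 = 0.
Proof.
apply/ffunP => i; rewrite ffunE oddz_zigzag leq0n !ffunE /sgz_bool.
by case: odd.
Qed.

Lemma vtx0_oddz s i : vtx s 0 = 0 -> oddz (s.1.1 i) = - sgz_bool (s.2 i).
Proof. by move=> /ffunP /(_ i); rewrite !ffunE leq0n => /eqP; rewrite addr_eq0 => /eqP. Qed.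

Lemma vtx0_le1 s j i : vtx s 0 = 0 -> `|vtx s j i| <= 1.
Proof.
move=> /(vtx0_oddz i) h; rewrite ffunE h.
by case: leqP => _; case: (s.2 i).
Qed.

Lemma lexpos_vtx s k (i : 'I_n.+1) : vtx s 0 = 0 -> s.1.2 = perm (@rev_ord_inj _) ->
  (k + i = n)%N -> lexpos (vtx s k.+1) = (0 < oddz (s.1.1 i)).
Proof.
move=> s0 sr ki; have vi : vtx s k.+1 i = oddz (s.1.1 i).
  by rewrite ffunE sr permE /=; case: leqP; rewrite ?addr0 //; lia.
rewrite (@lexposE _ _ i) ?vi ?oddz_neq0 // => j ji.
rewrite ffunE (vtx0_oddz _ s0) sr permE /= ifT ?addNr //; lia.
Qed.

Lemma sign_changes_lex s (k : 'I_n) : vtx s 0 = 0 -> sign_changes 0 s ->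
  lexpos (vtx s k.+1) != lexpos (vtx s k.+2).
Proof.
move=> s0 /forallP /(_ k); rewrite /= ?ltn0 !eps_lex ?vtx_neq0 //;
  by move=> j; exact: vtx0_le1.
Qed.

Lemma sign_changes_zigzag : sign_changes 0 zigzag.
Proof.
apply/forallP => k; rewrite /= ?ltn0 !eps_lex ?vtx_neq0 //; last 2 first.
- by move=> j; exact: vtx0_le1 zigzag_vtx0.
- by move=> j; exact: vtx0_le1 zigzag_vtx0.
have kn := ltn_ord k.
have h1 : (n - k < n.+1)%N by lia.
have h2 : (n - k.+1 < n.+1)%N by lia.
rewrite (@lexpos_vtx _ k (Ordinal h1) zigzag_vtx0) /=; [|by []|lia].
rewrite (@lexpos_vtx _ k.+1 (Ordinal h2) zigzag_vtx0) /=; [|by []|lia].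
rewrite !oddz_zigzag /=; have -> : (n - k = (n - k.+1).+1)%N by lia.
by rewrite /=; case: odd.
Qed.

(** The lexicographic sign must change at each step, so each coordinate that becomes odd must
    precede all those already odd. This forces the order; the sign of coordinate 0 then determines
    all the others. *)
Lemma zigzag_unique s : vtx s 0 = 0 -> 0 < oddz (s.1.1 ord0) ->
  sign_changes 0 s -> s = zigzag.
Proof.
move=> s0 q0 sc.
(* Otherwise the step making coordinate i odd acts behind the nonzero coordinate i' and cannot
   change the lexicographic sign. *)
have dec i i' : (s.1.2 i' < s.1.2 i)%N -> (i < i')%N.
  move=> ri; rewrite ltnNge; apply/negP => i'i.
  have rn : ((s.1.2 i).-1 < n)%N by have := ltn_ord (s.1.2 i); lia.
  have := sign_changes_lex (Ordinal rn) s0 sc.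
  rewrite (@eq_lexpos _ (vtx s (Ordinal rn).+1) (vtx s (Ordinal rn).+2) i') ?eqxx //.
    rewrite ffunE /= ifF ?addr0 ?oddz_neq0 //; apply/negbTE; lia.
  move=> j ji'; rewrite !ffunE /=.
  have jr : j = i -> s.1.2 j = s.1.2 i by move=> ->.
  have [ji|ji] := eqVneq (s.1.2 j) (s.1.2 i).
    move/perm_inj in ji; rewrite ji in ji'.
    have ii' : i = i' by apply/val_inj => /=; lia.
    by rewrite ii' ltnn in ri.
  have -> // : ((s.1.2 i).-1.+2 <= s.1.2 j)%N = ((s.1.2 i).-1.+1 <= s.1.2 j)%N.
  by move: ji; rewrite -val_eqE /=; lia.
have sr : s.1.2 = perm (@rev_ord_inj _).
  have H := @incr_ord_id n.+1 (fun i => rev_ord (s.1.2 i)).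
  apply/permP => i; rewrite permE -[LHS]rev_ordK H // => j k jk /=.
  have : (s.1.2 k < s.1.2 j)%N.
    rewrite ltnNge leq_eqVlt; apply/negP => /orP[/eqP/val_inj/perm_inj e|/dec].
      by rewrite e ltnn in jk.
    by rewrite ltnNge (ltnW jk).
  have := ltn_ord (s.1.2 j); lia.
have sgn k (kn : (k < n.+1)%N) : (0 < oddz (s.1.1 (Ordinal kn))) = ~~ odd k.
  elim: k kn => [|k IH] kn; first by rewrite (_ : Ordinal kn = ord0) ?q0 //; exact/val_inj.
  have k'n : (k < n.+1)%N by lia.
  have ln : (n - k.+1 < n)%N by lia.
  have := sign_changes_lex (Ordinal ln) s0 sc.
  rewrite (@lexpos_vtx _ _ (Ordinal kn) s0 sr) /=; last by lia.
  rewrite (@lexpos_vtx _ _ (Ordinal k'n) s0 sr) /=; last by lia.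
  by rewrite (IH k'n); case: (0 < _); case: (odd k).
have t i : s.2 i = odd i.
  have := sgn i (ltn_ord i).
  have -> : Ordinal (ltn_ord i) = i by exact/val_inj.
  by rewrite (vtx0_oddz _ s0); case: (s.2 i); case: odd.
move: s0 sr t => {sgn dec q0 sc}; case: s => [[q r] t] s0 /= -> tE.
congr (_, _, _); apply/ffunP => i; last by rewrite ffunE tE.
apply: oddz_inj; rewrite oddz_zigzag.
by have := vtx0_oddz i s0; rewrite /= tE => ->; case: odd.
Qed.

Lemma sign_changes_flip s : sign_changes 0 (flip_flag s) = sign_changes 0 s.
Proof. by apply: eq_forallb => i; rewrite /= ?ltn0 !vtx_flip. Qed.

(* Flags through 0 lack their partner under flip_flag; among them only zigzag
   has alternating lexicographic signs. *)
Lemma sum_sign_changes0 :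
  \big[addb/false]_(s | C s.1.1 && lexpos (vtx s 0)) sign_changes 0 s = true.
Proof.
pose P0 s := vtx s 0 != 0.
(* The half of the flags selected by the sign of [vtx s 0] is replaced by the half selected by the
   first coordinate of the cube, which [flip_flag] preserves. Flags satisfying exactly one of the
   two conditions are paired by [opp_flag]. *)
have -> : \big[addb/false]_(s | C s.1.1 && lexpos (vtx s 0)) sign_changes 0 s =
    \big[addb/false]_(s | [&& C s.1.1, P0 s & 0 < oddz (s.1.1 ord0)]) sign_changes 0 s.
  apply: addb_inj_false.
  rewrite big_mkcond [X in _ (+) X]big_mkcond -big_split /=.
  pose P s := [&& C s.1.1, P0 s & lexpos (vtx s 0) (+) (0 < oddz (s.1.1 ord0))].
  rewrite (eq_bigr (fun s => if P s then sign_changes 0 s else false)); last first.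
    move=> s _; rewrite /P; case: (C _) => //=.
    have := @lexpos_neq0 _ (vtx s 0); rewrite -/(P0 s).
    case: (P0 s) => /= [_|].
      by case: lexpos; case: (0 < _); case: (sign_changes _ _).
    by case: lexpos => // /(_ isT).
  rewrite -big_mkcond; apply: (addb_involution (@opp_flagK n m)) => s.
  - by move=> _; exact: opp_flag_neq.
  - move=> /and3P[Cs Ps xs]; apply/and3P; split; first by rewrite C_opp.
      by rewrite /P0 vtx_opp oppr_eq0.
    rewrite vtx_opp lexposN // ffunE oddzN oppr_gt0; move: xs.
    by have := oddz_neq0 (s.1.1 ord0); case: ltgtP => // _ _; case: lexpos.
  - by move=> _; exact: sign_changes_opp.
rewrite (bigID (fun s => P0 (flip_flag s))) /=.
rewrite [X in X (+) _](addb_involution (@flip_flagK n m)) /=; first last.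
- by move=> s _; exact: sign_changes_flip.
- move=> s /andP[/and3P[Cs P0s q0]] P0f; rewrite /= flip_flagK P0f P0s Cs /=.
  by rewrite q0.
- by move=> s _; exact: flip_flag_neq.
rewrite (eq_bigr (fun s => if sign_changes 0 s then true else false)); last first.
  by move=> s _; case: sign_changes.
rewrite -big_mkcondr /= (eq_bigl (pred1 (flip_flag zigzag))) ?big_pred1_eq // => s.
rewrite /P0 /= negbK; apply/idP/eqP => [/andP[/andP[/and3P[Cs s0 q0] /eqP f0] sc]|->].
  rewrite -(zigzag_unique f0) ?flip_flagK ?sign_changes_flip //.
rewrite flip_flagK zigzag_vtx0 eqxx sign_changes_flip sign_changes_zigzag !andbT.
apply/and3P; split.
- by apply: C_center => i; rewrite ffunE oddz_zigzag; case: odd.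
- apply/eqP => /ffunP /(_ ((zigzag.1.2)^-1 ord0)%g).
  rewrite !ffunE permKV /= ?ffunE /=; case: odd => /=;
    by rewrite ?oddzN oddz_mid.
- by rewrite oddz_zigzag.
Qed.

(** The product [sign_changes n] does not involve the top vertex. If [top_flag] never left [C] from
    a counted flag, it would pair the counted flags, but their number is odd. *)
Lemma tucker_flags : exists s, [/\ vtx s 0 != 0, sign_changes n s,
  C s.1.1 & ~~ C (top_flag s).1.1].
Proof.
pose B := [pred s | [&& vtx s 0 != 0, sign_changes n s, C s.1.1 & ~~ C (top_flag s).1.1]].
case: (pickP B) => [s /and4P[]|noB]; first by exists s.
have Tk k : (k <= n)%N ->
    \big[addb/false]_(s | C s.1.1 && lexpos (vtx s 0)) sign_changes k s = true.
  elim: k => [|k IH] kn; first exact: sum_sign_changes0.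
  by rewrite sum_sign_changesS // IH // ltnW.
suff : \big[addb/false]_(s | C s.1.1 && lexpos (vtx s 0)) sign_changes n s = false.
  by rewrite Tk.
rewrite (eq_bigr (fun s => if sign_changes n s then true else false)); last first.
  by move=> s _; case: sign_changes.
rewrite -big_mkcondr /=; apply: (addb_involution (@top_flagK n m)) => // s.
  by move=> _; exact: top_flag_neq.
move=> /andP[/andP[Cs lp] sc]; have qi := C_inner Cs.
have v j : (j <= n)%N -> vtx (top_flag s) j = vtx s j by exact: vtx_top.
rewrite v // lp /=; have := noB s.
rewrite /= sc Cs lexpos_neq0 //= => /negbFE ->.
apply/forallP => k; have := forallP sc k; rewrite ltn_ord !v //.
by rewrite ltnW.
Qed.

End Parity.

(** * Zeros of odd maps *)

Section MetricForms.
Context {R : realType}.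

Lemma continuousP_norm (U V : normedModType R) (f : U -> V) :
  continuous f <-> forall x e, 0 < e -> exists2 d, 0 < d &
    forall y, `|y - x| < d -> `|f y - f x| < e.
Proof.
split=> [cf x e e0|H x].
  have /cvgrPdistC_lt /(_ e e0) /nbhs_normP[d d0 Hd] := cf x.
  by exists d => // y yx; apply: Hd; rewrite /= distrC.
apply/cvgrPdistC_lt => e e0; have [d d0 Hd] := H x e e0.
by apply/nbhs_normP; exists d => // y yx; apply: Hd; rewrite distrC.
Qed.

Lemma continuous_gt (U : normedModType R) (f : U -> R) (a : R) x :
  continuous f -> a < f x ->
  exists2 d, 0 < d & forall y, `|y - x| < d -> a < f y.
Proof.
move=> /continuousP_norm cf ax; have [|d d0 Hd] := cf x (f x - a).
  by rewrite subr_gt0.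
exists d => // y /Hd; rewrite ltr_norml => /andP[+ _]; lra.
Qed.

Lemma continuous_lt (U : normedModType R) (f : U -> R) (a : R) x :
  continuous f -> f x < a ->
  exists2 d, 0 < d & forall y, `|y - x| < d -> f y < a.
Proof.
move=> /continuousP_norm cf ax; have [|d d0 Hd] := cf x (a - f x).
  by rewrite subr_gt0.
exists d => // y /Hd; rewrite ltr_norml => /andP[_]; lra.
Qed.

Lemma compact_seq (V : normedModType R) (A : set V) (u : nat -> V) :
  compact A -> (forall k, A (u k)) ->
  exists2 x, A x & forall e N, 0 < e -> exists2 k, (N <= k)%N & `|u k - x| < e.
Proof.
move=> cA uA; have [|x [Ax cx]] := cA (u @ \oo) _.
  by exists 0%N => // k _; exact: uA.
exists x => // e N e0.
have uN : (u @ \oo) [set u k | k in [set k | (N <= k)%N]].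
  by exists N => // k Nk; exists k.
have xe : nbhs x [set y | `|y - x| < e].
  by apply/nbhs_normP; exists e => // y; rewrite /= distrC.
by have [_ [[k Nk <-]]] := cx _ _ uN xe; exists k.
Qed.

Lemma invS_small (e : R) : 0 < e -> exists N, forall k, (N <= k)%N -> k.+1%:R^-1 < e.
Proof.
move=> e0; have [N HN] := ltr_add_invr e0; exists N => k Nk.
rewrite add0r in HN; apply: le_lt_trans HN.
by rewrite lef_pV2 ?posrE ?ltr0n // ler_nat.
Qed.

Lemma rV_norm_le n (y : 'rV[R]_n) e : 0 <= e ->
  (forall i, `|y ord0 i| <= e) -> `|y| <= e.
Proof.
move=> e0 H; have -> : `|y| = mx_norm y by [].
rewrite mx_normrE; apply: bigmax_le => // -[i j] _ /=.
by rewrite (ord1 i).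
Qed.

Lemma rV_le_norm n (y : 'rV[R]_n) i : `|y ord0 i| <= `|y|.
Proof.
have -> : `|y| = mx_norm y by [].
by rewrite mx_normrE; apply: (le_bigmax _ (fun p => `|y p.1 p.2|) (ord0, i)).
Qed.

Lemma compact_rV_ball n (r : R) : compact [set y : 'rV[R]_n | `|y| <= r].
Proof.
apply: bounded_closed_compact.
  by exists r; split; [exact: num_real|move=> x rx y /= yr; exact: le_trans (ltW rx)].
have -> : [set y : 'rV[R]_n | `|y| <= r] = (fun y => `|y|) @^-1` [set t | t <= r] by [].
by apply: preimage_closed => [y _|]; [exact: norm_continuous|exact: closed_le].
Qed.

End MetricForms.

Section OddZero.
Context {R : realType}.
Variables (n : nat) (f : 'I_n -> 'rV[R]_n.+1 -> R) (s : 'rV[R]_n.+1 -> R) (r : R).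
Hypothesis f_cont : forall i, continuous (f i).
Hypothesis f_odd : forall i y, f i (- y) = - f i y.
Hypothesis s_cont : continuous s.
Hypothesis s_even : forall y, s (- y) = s y.
Hypothesis s0 : s 0 < 0.
Hypothesis s_out : forall y, r <= `|y| -> 0 < s y.

(** [tucker_flags] is applied to a fine grid, with the signs of the [f i] as labels and the cubes
    whose centre has [s < 0] as region. The flag found crosses the border of the region and sees
    every [f i] change sign. *)
Lemma odd_zero_approx (e : R) : 0 < e -> exists x x' : 'rV[R]_n.+1,
  [/\ s x < 0, 0 <= s x', `|x' - x| <= e & forall i, exists p p',
    [/\ `|p - x| <= e, `|p' - x| <= e, f i p <= 0 & 0 <= f i p']].
Proof.
move=> e0; have [d0 d00 Hd0] := continuous_lt s_cont s0.
(* Centres of adjacent cubes are at most [2 d] apart; points with grid coordinates at most 4 must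
   still satisfy [s < 0]. *)
have [d [d_gt0 de dd0]] : exists d, [/\ 0 < d, d *+ 2 <= e & d *+ 4 < d0].
  exists (Num.min (e / 2) (d0 / 5)); rewrite lt_min; split; first by lra.
    by rewrite [X in _ <= X](splitr e) mulr2n lerD // ge_min lexx.
  apply: le_lt_trans (_ : (d0 / 5) *+ 4 < _); first by rewrite ler_wMn2r // ge_min lexx orbT.
  rewrite -mulr_natr; lra.
have near0 (y : 'rV[R]_n.+1) : (forall i, `|y ord0 i| <= d *+ 4) -> s y < 0.
  move=> H; apply: Hd0; rewrite subr0; apply: le_lt_trans dd0.
  by apply: rV_norm_le => //; rewrite mulrn_wge0 // ltW.
(* The grid is wide enough that the cubes at its border have their centres beyond radius r. *)
have [m m0 md] : exists2 m, (0 < m)%N & `|r| < d * m%:R.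
  exists (Num.truncn (`|r| / d)).+1 => //.
  by rewrite mulrC -ltr_pdivrMr //; exact: truncnS_gt.
pose pt (p : {ffun 'I_n.+1 -> int}) : 'rV[R]_n.+1 := \row_i (d * (p i)%:~R).
have ptN p : pt (- p) = - pt p.
  by apply/rowP => i; rewrite !mxE ffunE mulrNz mulrN.
have pt_norm (p : {ffun 'I_n.+1 -> int}) i k : `|p i| <= k%:Z -> `|pt p ord0 i| <= d *+ k.
  move=> H; rewrite mxE normrM gtr0_norm // -mulr_natr ler_pM2l //.
  by rewrite -intr_norm (ler_int _ _ k).
have pt_close (p p' : {ffun 'I_n.+1 -> int}) k : (forall i, `|p i - p' i| <= k%:Z) -> `|pt p - pt p'| <= d *+ k.
  move=> H; apply: rV_norm_le; first by rewrite mulrn_wge0 // ltW.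
  move=> i; have := @pt_norm (p - p') i k; rewrite !ffunE => /(_ (H i)).
  by rewrite !mxE !ffunE intrD mulrDr mulrNz mulrN.
pose small (p : {ffun 'I_n.+1 -> int}) := [forall j, `|p j| <= 1].
have smallN p : small (- p) = small p.
  by apply: eq_forallb => j; rewrite ffunE normrN.
(* The lexicographic sign breaks ties at the zeros of [f i] and overrides [f i] next to 0. *)
pose eps i p := if small p || (f i (pt p) == 0) then lexpos p else 0 < f i (pt p).
pose C (q : {ffun 'I_n.+1 -> 'I_m.*2}) := s (pt (center q)) < 0.
have eps_opp i p : p != 0 -> eps i (- p) = ~~ eps i p.
  move=> p0; rewrite /eps smallN ptN f_odd oppr_eq0 lexposN //.
  case: ifP => // /negbT; rewrite negb_or => /andP[_ fp].
  by rewrite oppr_gt0 -leNgt le_eqVlt (negbTE fp).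
have eps_lex i (p : {ffun 'I_n.+1 -> int}) : p != 0 -> (forall j, `|p j| <= 1) ->
    eps i p = lexpos p.
  by move=> _ H; rewrite /eps ifT //; apply/orP; left; apply/forallP.
have C_opp q : C (opp_cube q) = C q by rewrite /C center_opp ptN s_even.
have C_inner q : C q -> inner_cube q.
  rewrite /C => sq; apply/forallP => i; apply: contraTT sq => qi.
  rewrite -leNgt ltW //; apply: s_out.
  apply: le_trans (rV_le_norm _ i); rewrite mxE ffunE normrM gtr0_norm //.
  apply: le_trans (ler_norm _) _; apply: (le_trans (ltW md)).
  rewrite ler_pM2l // -intr_norm; have -> : m%:R = (m%:Z)%:~R :> R by [].
  rewrite ler_int; move: qi; rewrite /oddz; have := ltn_ord (q i); lia.
have C_center q : (forall i, `|center q i| <= 1) -> C q.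
  move=> H; apply: near0 => i; apply: (le_trans (pt_norm _ _ 1%N (H i))).
  by rewrite ler_wpMn2l // ltW.
have [fl [v0 sc Cq nCq]] :=
  tucker_flags m0 eps_opp eps_lex C_opp C_inner C_center.
set q := fl.1.1 in Cq *; set q' := (top_flag fl).1.1 in nCq *.
have qq' i : `|center q' i - center q i| <= 2%:Z.
  rewrite !ffunE /=; case: ifP => _; rewrite ?subrr //.
  rewrite oddz_move; last by exact: (forallP (C_inner _ Cq) i).
  by rewrite addrAC subrr add0r; case: (fl.2 i).
have vq j i : `|vtx fl j i - center q i| <= 1%:Z.
  rewrite !ffunE addrAC subrr add0r; case: ifP => // _; by case: (fl.2 i).
(* A vertex next to 0 would put the centre of [q'] within 1 + 1 + 2 = 4 grid units of 0, where
   [s < 0]; so the override does not affect this flag. *)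
have not_small j : ~~ small (vtx fl j).
  apply: contra nCq => /forallP H; apply: near0 => i; apply: pt_norm.
  have := H i; have := vq j i; have := qq' i; lia.
have sgn i j : eps i (vtx fl j) -> 0 <= f i (pt (vtx fl j)).
  rewrite /eps (negbTE (not_small j)) /=; case: eqP => [->//|_]; exact: ltW.
have sgnN i j : ~~ eps i (vtx fl j) -> f i (pt (vtx fl j)) <= 0.
  rewrite /eps (negbTE (not_small j)) /=; case: eqP => [->//|_]; by rewrite leNgt.
exists (pt (center q)), (pt (center q')); split => //.
- by rewrite leNgt.
- exact: le_trans (pt_close _ _ _ qq') de.
move=> i; have cl j : `|pt (vtx fl j) - pt (center q)| <= e.
  apply: le_trans (pt_close _ _ _ (vq j)) _; apply: le_trans de.
  by rewrite ler_wpMn2l // ltW.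
have := forallP sc i; rewrite ltn_ord.
case: (boolP (eps i (vtx fl i))) => [/sgn e1|/sgnN e1];
  case: (boolP (eps i (vtx fl i.+1))) => [/sgn e2|/sgnN e2] // _.
- by exists (pt (vtx fl i.+1)), (pt (vtx fl i)).
- by exists (pt (vtx fl i)), (pt (vtx fl i.+1)).
Qed.

(** A limit of the approximate solutions: if [f i] or [s] were nonzero there, it would have a
    constant strict sign nearby, contrary to the signs found arbitrarily close. The approximations
    stay in the ball of radius r because [s < 0] at them. *)
Lemma odd_zero : exists y, (forall i, f i y = 0) /\ s y = 0.
Proof.
have inv0 k : 0 < k.+1%:R^-1 :> R by rewrite invr_gt0 ltr0n.
have [x xP] := choice (fun k => odd_zero_approx (inv0 k)).
have [y _ cy] : exists2 y, `|y| <= r &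
    forall e N, 0 < e -> exists2 k, (N <= k)%N & `|x k - y| < e.
  apply: (compact_seq (@compact_rV_ball R n.+1 r)) => k /=.
  have [x' [sx _ _ _]] := xP k; rewrite leNgt; apply/negP => /ltW /s_out.
  by move=> /(lt_trans sx); rewrite ltxx.
have close (d : R) : 0 < d -> exists k, `|x k - y| < d / 2 /\ k.+1%:R^-1 < d / 2.
  move=> d0; have d2 : 0 < d / 2 by lra.
  have [N HN] := invS_small d2; have [k Nk xk] := cy _ N d2.
  by exists k; split=> //; exact: HN.
have near (d : R) k (z : 'rV[R]_n.+1) : `|x k - y| < d / 2 -> k.+1%:R^-1 < d / 2 ->
    `|z - x k| <= k.+1%:R^-1 -> `|z - y| < d.
  move=> h1 h2 h3; apply: le_lt_trans (ler_distD (x k) _ _) _.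
  by rewrite [ltRHS]splitr ltrD // (le_lt_trans h3 h2).
exists y; split=> [i|].
- have [fy|fy|//] := ltgtP (f i y) 0.
    have [d d0 Hd] := continuous_lt (@f_cont i) fy; have [k [h1 h2]] := close d d0.
    have [x' [_ _ _ /(_ i) [p [p' [_ hp' _]]]]] := xP k.
    by rewrite leNgt Hd // (near d k).
  have [d d0 Hd] := continuous_gt (@f_cont i) fy; have [k [h1 h2]] := close d d0.
  have [x' [_ _ _ /(_ i) [p [p' [hp _]]]]] := xP k.
  by rewrite leNgt Hd // (near d k).
- have [sy|sy|//] := ltgtP (s y) 0.
    have [d d0 Hd] := continuous_lt s_cont sy; have [k [h1 h2]] := close d d0.
    have [x' [_ + hx' _]] := xP k.
    by rewrite leNgt Hd // (near d k).
  have [d d0 Hd] := continuous_gt s_cont sy; have [k [h1 h2]] := close d d0.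
  have [x' [+ _ _ _]] := xP k.
  by rewrite ltNge ltW // Hd // (lt_trans h1) //; lra.
Qed.

End OddZero.

(** * Deformations *)

Section Completeness.
Context {R : realType}.

Lemma compact_ub (U : normedModType R) (f : U -> R) (A : set U) :
  continuous f -> compact A -> exists M, forall x, A x -> f x <= M.
Proof.
move=> cf cA; have [->|/set0P A0] := eqVneq A set0; first by exists 0.
have [|m mA Hm] := compact_EVT_max A0 cA (f := f).
  exact: continuous_subspaceT.
by exists (f m) => x Ax; apply/Hm/mem_set.
Qed.

Lemma compact_lb_gt0 (U : normedModType R) (f : U -> R) (A : set U) :
  continuous f -> compact A -> (forall x, A x -> 0 < f x) ->
  exists2 m, 0 < m & forall x, A x -> m <= f x.
Proof.
move=> cf cA f0; have [->|/set0P A0] := eqVneq A set0; first by exists 1.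
have [|m mA Hm] := compact_EVT_min A0 cA (f := f).
  exact: continuous_subspaceT.
exists (f m); first exact/f0/set_mem.
by move=> x Ax; apply/Hm/mem_set.
Qed.

Lemma complete_seq (Z : completeNormedModType R) (u : nat -> Z) :
  (forall e, 0 < e -> exists N, forall k, (N <= k)%N -> `|u k - u N| < e) ->
  exists l, forall e, 0 < e -> exists N, forall k, (N <= k)%N -> `|u k - l| < e.
Proof.
move=> H; have /cauchy_cvgP cu : cauchy (u @ \oo).
  apply/cauchyP => e e0; have [N HN] := H e e0; exists (u N).
  by exists N => // k Nk; rewrite -ball_normE /= distrC; exact: HN.
exists (lim (u @ \oo)) => e e0.
have /cvgrPdistC_lt /(_ e e0) [N _ HN] := cu.
by exists N => k Nk; exact: HN.
Qed.

Lemma uniform_limit (U : normedModType R) (Z : completeNormedModType R)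
    (h : nat -> U -> Z) (e : nat -> R) :
  (forall k, continuous (h k)) ->
  (forall k l y, (k <= l)%N -> `|h l y - h k y| <= e k) ->
  (forall d, 0 < d -> exists k, e k < d) ->
  exists g : U -> Z, [/\ continuous g, forall k y, `|g y - h k y| <= e k &
    forall y d, 0 < d -> exists N, forall k, (N <= k)%N -> `|h k y - g y| < d].
Proof.
move=> hc he e0; have /choice[g gP] : forall y, exists l, forall d, 0 < d ->
    exists N, forall k, (N <= k)%N -> `|h k y - l| < d.
  move=> y; apply: complete_seq => d /e0[N eN]; exists N => k Nk.
  exact: le_lt_trans (he _ _ _ Nk) eN.
have ge k y : `|g y - h k y| <= e k.
  apply/ler_addgt0Pl => d d0; have [N HN] := gP y d d0.
  have := HN (maxn N k) (leq_maxl _ _); have := he k (maxn N k) y (leq_maxr _ _).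
  have := ler_distD (h (maxn N k) y) (g y) (h k y).
  rewrite [`|g y - h (maxn N k) y|]distrC; lra.
exists g; split=> //; apply/continuousP_norm => x d d0.
have d3 : 0 < d / 3 by lra.
have [k ek] := e0 _ d3; have /continuousP_norm /(_ x _ d3)[r r0 Hr] := hc k.
exists r => // y /Hr; have := ge k x; have := ge k y.
have := ler_distD (h k y) (g y) (g x); have := ler_distD (h k x) (h k y) (g x).
rewrite [`|h k x - g x|]distrC; lra.
Qed.

(* Brezis-Browder ordering principle. *)
Lemma exists_Phi_maximal (T : Type) (le : T -> T -> Prop) (Phi : T -> R) (m : R) :
  (forall x, le x x) -> (forall x y z, le x y -> le y z -> le x z) ->
  (forall x, m <= Phi x) ->
  (forall u : nat -> T, (forall k, le (u k) (u k.+1)) -> exists v, forall k, le (u k) v) ->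
  (forall x y, le x y -> Phi y <= Phi x) ->
  forall x, exists2 y, le x y & forall z, le y z -> Phi y <= Phi z.
Proof.
move=> lexx letr Phim ub mono x0.
(* The successor [f x] at least halves the gap between [Phi x] and the infimum of [Phi] above x. *)
have /choice[f fP] : forall x, exists y, le x y /\
    forall z, le x z -> Phi y *+ 2 <= Phi z + Phi x.
  move=> x; pose S := [set Phi z | z in [set z | le x z]].
  have S0 : S !=set0 by exists (Phi x), x.
  have Slb : has_inf S by split => //; exists m => _ [z _ <-].
  have Sx : inf S <= Phi x by apply: ge_inf; [case: Slb|exists x].
  have lb z : le x z -> inf S <= Phi z by move=> xz; apply: ge_inf; [case: Slb|exists z].
  have [xS|xS] := eqVneq (Phi x) (inf S).
    by exists x; split=> // z /lb; rewrite -xS mulr2n; lra.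
  have [|_ [y xy <-] yS] := @inf_adherent _ S ((Phi x - inf S) / 2) _ Slb.
    by rewrite divr_gt0 // subr_gt0 lt_neqAle eq_sym xS.
  by exists y; split=> // z /lb; rewrite mulr2n; lra.
pose u := fix u k := if k is k'.+1 then f (u k') else x0.
have uS k : le (u k) (u k.+1) by case: (fP (u k)).
have [v uv] := ub u uS; exists v; first exact: uv 0%N.
move=> z vz; have uz k : le (u k) z by exact: letr (uv k) vz.
have geo k : Phi (u k) - Phi z <= (Phi x0 - Phi z) / (2 ^+ k).
  elim: k => [|k IH]; first by rewrite expr0 divr1.
  have [_ /(_ z (uz k))] := fP (u k); rewrite -/(u k.+1) exprS invfM mulrCA mulr2n.
  move: IH; move: (_ / 2 ^+ k) => t; lra.
have [x0z|x0z] := leP (Phi x0) (Phi z).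
  exact: le_trans (mono _ _ (uv 0%N)) x0z.
apply/ler_addgt0Pl => d d0.
have [N HN] := @invS_small R (d / (Phi x0 - Phi z)) (divr_gt0 d0 (eqbRL (subr_gt0 _ _) x0z)).
have := geo N; have := mono _ _ (uv N).
have : (Phi x0 - Phi z) / 2 ^+ N <= d.
  rewrite mulrC -ler_pdivlMr ?subr_gt0 //; apply: le_trans (ltW (HN N (leqnn N))).
  rewrite lef_pV2 ?posrE ?exprn_gt0 ?ltr0n // -natrX ler_nat; exact: ltn_expl.
lra.
Qed.

End Completeness.

Section Deformation.
Context {R : realType}.
Variables (Y : normedModType R) (Z : completeNormedModType R).
Variables (J : Z -> R) (G : set Z) (c lam : R) (A : set Y).
Hypothesis J_cont : continuous J.
Hypothesis J_even : forall u, J (- u) = J u.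
Hypothesis G_closed : closed G.
Hypothesis G_sym : forall u, G u -> G (- u).
Hypothesis c_gt0 : 0 < c.
Hypothesis lam_gt0 : 0 < lam.
Hypothesis A_compact : compact A.

(** A direction of descent valid uniformly near u. It records that [G] is preserved, so that [G] may
    be a sublevel set of a penalised functional. *)
Definition steep (u V : Z) (d : R) := [/\ `|V| <= 1, 0 < d &
  forall w t, G w -> `|w - u| < d -> 0 <= t -> t < d ->
    G (w + t *: V) /\ J (w + t *: V) <= J w - lam * t].

Lemma steepN u V d : steep u V d -> steep (- u) (- V) d.
Proof.
move=> [V1 d0 H]; split; rewrite ?normrN // => w t Gw wu t0 td.
have [|GV JV] := H (- w) t (G_sym Gw) _ t0 td.
  by rewrite -opprD normrN; rewrite opprK in wu.
have e : w + t *: - V = - (- w + t *: V) by rewrite opprD opprK scalerN.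
by rewrite e J_even -[J w]J_even; split => //; apply: G_sym.
Qed.

(** The moves are made one after the other, since [G] need not be convex. The total displacement
    from w is at most t, hence at most [d i / 2], so each move starts within [d i] of [p i]. *)
Lemma steep_sum (I : eqType) (s : seq I) (a d : I -> R) (p V : I -> Z) (t : R) w x :
  (forall i, i \in s -> [/\ steep (p i) (V i) (d i), 0 <= a i, t <= d i / 2 &
     0 < a i -> `|w - p i| < d i / 2]) ->
  0 < t -> \sum_(i <- s) a i <= 1 ->
  G x -> `|x - w| + t * \sum_(i <- s) a i <= t ->
  let x' := x + t *: \sum_(i <- s) a i *: V i in
  [/\ G x', J x' <= J x - lam * t * \sum_(i <- s) a i &
      `|x' - x| <= t * \sum_(i <- s) a i].
Proof.
move=> + t0; elim: s x => [|i s IH] x H a1 Gx xw.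
  by rewrite /= !big_nil scaler0 addr0 !mulr0 subr0 subrr normr0.
rewrite /= !big_cons in a1 xw *.
have [[V1 d0 st] ai td wp] := H i (mem_head _ _).
have Hs j : j \in s -> _ := fun js => H j (mem_behead (s := i :: s) js).
have s0 : 0 <= \sum_(j <- s) a j by rewrite big_seq sumr_ge0 // => j /Hs[].
have ts0 : 0 <= t * \sum_(j <- s) a j by rewrite mulr_ge0 // ltW.
have tai : 0 <= t * a i by rewrite mulr_ge0 // ltW.
rewrite mulrDr in xw.
have nV : `|(t * a i) *: V i| <= t * a i.
  by rewrite normrZ ger0_norm // -[leRHS]mulr1 ler_wpM2l.
have [Gx1 Jx1] : G (x + (t * a i) *: V i) /\
    J (x + (t * a i) *: V i) <= J x - lam * (t * a i).
  have [a0|a0] := eqVneq (a i) 0.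
    by rewrite a0 !mulr0 scale0r addr0 subr0.
  have {}a0 : 0 < a i by rewrite lt_neqAle eq_sym a0.
  apply: st => //.
    have := wp a0; have := ler_distD w x (p i); lra.
  have : t * a i <= t * 1 by apply: ler_wpM2l; [exact: ltW|lra].
  lra.
have [||||G2 J2 n2] := IH (x + (t * a i) *: V i) => //; first by lra.
  have := ler_normD (x - w) ((t * a i) *: V i); rewrite addrAC; lra.
rewrite scalerDr scalerA addrA; split => //; first by lra.
move: n2; set y := x + (t * a i) *: V i; set z := y + _ => n2.
have yx : y - x = (t * a i) *: V i by rewrite /y addrAC subrr add0r.
have := ler_distD y z x; rewrite yx; lra.
Qed.

Lemma continuous_bigsum (I : Type) (U V : normedModType R) (s : seq I) (F : I -> U -> V) :
  (forall i, continuous (F i)) -> continuous (fun x => \sum_(i <- s) F i x).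
Proof. by move=> cF x; apply: cvg_big => [|i _]; [exact: add_continuous|exact: cF]. Qed.

Lemma continuousN_arg (U V : normedModType R) (f : U -> V) :
  continuous f -> continuous (fun x => f (- x)).
Proof. by move=> cf x; apply: continuous_comp; [exact: opp_continuous|exact: cf]. Qed.

Lemma continuous_maxr (U : normedModType R) (f g : U -> R) :
  continuous f -> continuous g -> continuous (fun x => Num.max (f x) (g x)).
Proof. by move=> cf cg x; exact: (continuous_max (cf x) (cg x)). Qed.

Section Step.
Variable h : Y -> Z.
Hypothesis h_cont : continuous h.
Hypothesis h_odd : forall y, h (- y) = - h y.
Hypothesis h_G : forall y, A y -> G (h y).
Hypothesis h_steep : forall y, A y -> c <= J (h y) -> exists V d, steep (h y) V d.

(** Descent directions at finitely many points are glued by a partition of unity into an odd field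
    [X], and one step of length t is made along it. Compactness of the part of A above level c makes
    t uniform. *)
Lemma deformation_step (Phi : R) : c < Phi -> (forall y, A y -> J (h y) <= Phi) ->
  exists (h' : Y -> Z) (t : R), [/\ 0 < t,
    [/\ continuous h', forall y, h' (- y) = - h' y & forall y, A y -> G (h' y)],
    forall y, J (h y) <= 0 -> h' y = h y,
    forall y, `|h' y - h y| <= t &
    c + lam * t <= Phi /\ forall y, A y -> J (h' y) <= Phi - lam * t].
Proof.
move=> cPhi hPhi; pose D := A `&` [set y | c <= J (h y)].
have Jh_cont : continuous (J \o h).
  by move=> y; apply: continuous_comp; [exact: h_cont|exact: J_cont].
have D_compact : compact D.
  apply: compact_closedI => //.
  have -> : [set y | c <= J (h y)] = (J \o h) @^-1` [set t | c <= t] by [].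
  by apply: preimage_closed => [y _|]; [exact: Jh_cont|exact: closed_ge].
(* The radius is also small enough that J is positive nearby, so points with [J <= 0] are not moved.
   Off [D] the value is a dummy. *)
have /choice[f fP] : forall y, exists Vd : Z * R, D y -> steep (h y) Vd.1 Vd.2 /\
    forall w, `|w - h y| < Vd.2 -> 0 < J w.
  move=> y; have [[Ay cy]|nD] := pselect (D y); last by exists (0, 0).
  have [V [d [V1 d0 st]]] := h_steep Ay cy.
  have [d' d'0 Hd'] := continuous_gt J_cont (lt_le_trans c_gt0 cy).
  exists (V, Num.min d d') => _ /=; split.
    split=> //; first by rewrite lt_min d0.
    by move=> w t Gw; rewrite !lt_min => /andP[wd _] t0 /andP[td _]; exact: st.
  by move=> w; rewrite lt_min => /andP[_]; exact: Hd'.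
pose d y := (f y).2; pose V y := (f y).1.
have d0 y : D y -> 0 < d y by move=> /fP[[]].
have [S SD covS] : finite_subset_cover D (fun y => [set z | `|h z - h y| < d y / 2]) D.
  have cD := D_compact; rewrite compact_cover in cD; apply: cD.
    move=> y Dy; have -> : [set z | `|h z - h y| < d y / 2] =
      (fun z => `|h z - h y|) @^-1` [set t | t < d y / 2] by [].
    apply: open_comp; last exact: open_lt.
    by move=> z _; apply: cvg_norm; apply: cvgB; [exact: h_cont|exact: cvg_cst].
  move=> y Dy; exists y => //=; rewrite subrr normr0.
  by have := d0 y Dy; lra.
pose s : seq Y := finmap.enum_fset S; have sD y : y \in s -> D y by move=> ys; exact/set_mem/SD.
pose b y w := Num.max 0 (d y / 2 - `|w - h y|).
have b_ge0 y w : 0 <= b y w by rewrite /b le_max lexx.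
have b_gt0 y w : 0 < b y w -> `|w - h y| < d y / 2.
  by rewrite /b lt_max ltxx /= subr_gt0.
have b_cont y : continuous (b y).
  apply: continuous_maxr => w; first exact: cvg_cst.
  apply: cvgB; first exact: cvg_cst.
  apply: cvg_norm; apply: cvgB; [exact: cvg_id|exact: cvg_cst].
pose N w := \sum_(y <- s) b y w + \sum_(y <- s) b y (- w).
have N_cont : continuous N.
  have c1 := @continuous_bigsum _ _ _ s b b_cont.
  have c2 := @continuous_bigsum _ _ _ s (fun y w => b y (- w)) (fun y => continuousN_arg (b_cont y)).
  by move=> w; apply: cvgD; [exact: c1|exact: c2].
have N_ge0 w : 0 <= N w by rewrite addr_ge0 // sumr_ge0.
have NN w : N (- w) = N w by rewrite /N opprK addrC.
have [eta eta0 N_eta] : exists2 eta, 0 < eta & forall y, D y -> eta <= N (h y).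
  apply: (@compact_lb_gt0 _ _ (N \o h)) => //.
    by move=> y; apply: continuous_comp; [exact: h_cont|exact: N_cont].
  move=> y Dy; have [z /= zS yz] := covS _ Dy; rewrite /= /N.
  have bz : 0 < b z (h y) by rewrite /b lt_max subr_gt0 yz orbT.
  apply: ltr_wpDr; first by rewrite sumr_ge0.
  rewrite (big_rem z) //=; apply: ltr_wpDr => //; by rewrite sumr_ge0.
(* The denominator never vanishes, and equals [N w] on the image of [D]: the weights sum to at most
   1 everywhere and to exactly 1 there. *)
pose th y w := b y w / Num.max (N w) eta.
have M0 w : 0 < Num.max (N w) eta by rewrite lt_max eta0 orbT.
have th_ge0 y w : 0 <= th y w by rewrite divr_ge0 // ltW.
have th_gt0 y w : 0 < th y w -> `|w - h y| < d y / 2.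
  by rewrite /th pmulr_lgt0 ?invr_gt0 //; exact: b_gt0.
have th_cont y : continuous (th y).
  move=> w; apply: cvgM; first exact: b_cont.
  apply: cvgV; first by rewrite gt_eqF.
  by apply: continuous_maxr => // z; exact: cvg_cst.
have th_sum w : \sum_(y <- s) th y w + \sum_(y <- s) th y (- w) = N w / Num.max (N w) eta.
  by rewrite /th -!mulr_suml NN -mulrDl.
have th_sum1 w : \sum_(y <- s) th y w + \sum_(y <- s) th y (- w) <= 1.
  by rewrite th_sum ler_pdivrMr // mul1r le_max lexx.
have th_sumD y : D y -> \sum_(z <- s) th z (h y) + \sum_(z <- s) th z (- h y) = 1.
  move=> Dy; rewrite th_sum; have := N_eta y Dy => Ny.
  by rewrite max_l // divff // gt_eqF // (lt_le_trans eta0).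
pose X w : Z := \sum_(y <- s) th y w *: V y + \sum_(y <- s) th y (- w) *: - V y.
have XN w : X (- w) = - X w.
  rewrite /X opprK opprD addrC -!sumrN; congr (_ + _);
    by apply: eq_bigr => y _; rewrite scalerN ?opprK.
have X_cont : continuous X.
  have c1 : continuous (fun w => \sum_(y <- s) th y w *: V y).
    apply: continuous_bigsum => y w; apply: cvgZ; [exact: th_cont|exact: cvg_cst].
  have c2 : continuous (fun w => \sum_(y <- s) th y (- w) *: - V y).
    apply: continuous_bigsum => y w; apply: cvgZ; last exact: cvg_cst.
    exact: (continuousN_arg (th_cont y)).
  by move=> w; apply: cvgD; [exact: c1|exact: c2].
have [t [t0 td tPhi]] : exists t, [/\ 0 < t, forall y, y \in s -> t <= d y / 2 &
    c + lam * t <= Phi].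
  have [t1 t10 t1P] : exists2 t, 0 < t & forall y, y \in s -> t <= d y / 2.
    suff H (s' : seq Y) : (forall y, y \in s' -> D y) ->
      exists2 t, 0 < t & forall y, y \in s' -> t <= d y / 2 by exact: H sD.
    elim: s' => [|y s' IH] sD'; first by exists 1.
    have [|t1 t10 t1P] := IH; first by move=> z zs; apply: sD'; rewrite in_cons zs orbT.
    have dy := d0 y (sD' y (mem_head _ _)).
    exists (Num.min t1 (d y / 2)); first by rewrite lt_min t10 divr_gt0.
    move=> z; rewrite in_cons => /orP[/eqP ->|/t1P zt].
      by rewrite ge_min lexx orbT.
    by rewrite ge_min zt.
  exists (Num.min t1 ((Phi - c) / lam)); split.
  - by rewrite lt_min t10 divr_gt0 // subr_gt0.
  - by move=> y /t1P yt; rewrite ge_min yt.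
  - by rewrite -lerBrDl mulrC -ler_pdivlMr // ge_min lexx orbT.
have move_down y : G (h y) -> [/\ G (h y + t *: X (h y)) &
    J (h y + t *: X (h y)) <= J (h y) - lam * t *
      (\sum_(z <- s) th z (h y) + \sum_(z <- s) th z (- h y))].
  move=> Gy; have h1 := th_sum1 (h y).
  have p1 : 0 <= \sum_(z <- s) th z (h y) by rewrite sumr_ge0.
  have p2 : 0 <= \sum_(z <- s) th z (- h y) by rewrite sumr_ge0.
  have [|//||//||] := @steep_sum Y s (th ^~ (h y)) d h V t (h y) (h y).
  - move=> z zs; split => //; [by have [] := fP z (sD z zs)|exact: td|exact: th_gt0].
  - by lra.
  - rewrite subrr normr0 add0r -[leRHS]mulr1; apply: ler_wpM2l; [exact: ltW|lra].
  set x1 := h y + _ => G1 J1 n1.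
  (* The antipodal directions are followed next, from the point reached; the weights of both halves
     together keep the path within t of [h y]. *)
  have [|//||//||] := @steep_sum Y s (th ^~ (- h y)) d (fun z => - h z) (fun z => - V z) t (h y) x1.
  - move=> z zs; split => //; [by apply: steepN; have [] := fP z (sD z zs)|exact: td|].
    by move=> /th_gt0; rewrite -opprD normrN opprK.
  - by lra.
  - apply: le_trans (lerD n1 (lexx _)) _; rewrite -mulrDr -[leRHS]mulr1.
    by apply: ler_wpM2l => //; exact: ltW.
  rewrite {1 2}/x1 -addrA -scalerDr => G2 J2 _; split=> //.
  by rewrite mulrDr; lra.
exists (fun y => h y + t *: X (h y)), t; split=> //.
- split.
  + move=> y; apply: cvgD; first exact: h_cont.
    apply: cvgZ; first exact: cvg_cst.
    by apply: continuous_comp; [exact: h_cont|exact: X_cont].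
  + by move=> y; rewrite h_odd XN scalerN opprD.
  + by move=> y /h_G /move_down[].
- move=> y Jy; have b0 z w : z \in s -> J w <= 0 -> th z w = 0.
    move=> zs Jw; apply/eqP; rewrite eq_le th_ge0 andbT leNgt; apply/negP => /th_gt0 wz.
    have [_ Hp] := fP z (sD z zs); have dz := d0 z (sD z zs).
    have : 0 < J w by apply: Hp; move: wz dz; rewrite /d; lra.
    by rewrite ltNge Jw.
  rewrite /X !big_seq !big1 ?addr0 ?scaler0 ?addr0 // => z zs;
    by rewrite b0 ?scale0r // J_even.
- move=> y; rewrite addrAC subrr add0r normrZ gtr0_norm // -[leRHS]mulr1; apply: ler_wpM2l; first exact: ltW.
  apply: le_trans (th_sum1 (h y)); apply: le_trans (ler_normD _ _) _; apply: lerD;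
    apply: le_trans (ler_norm_sum _ _ _) _; rewrite !big_seq; apply: ler_sum => z zs;
    rewrite normrZ ?normrN ger0_norm // -[leRHS]mulr1 ler_wpM2l //;
    by have [[]] := fP z (sD z zs).
- split=> // y Ay; have [_ Jy] := move_down y (h_G Ay); apply: le_trans Jy _.
  have [Dy|nDy] := leP c (J (h y)).
    by rewrite th_sumD ?mulr1 //; have := hPhi y Ay; lra.
  have : 0 <= lam * t * (\sum_(z <- s) th z (h y) + \sum_(z <- s) th z (- h y)).
    by rewrite mulr_ge0 ?addr_ge0 ?sumr_ge0 // ltW // mulr_gt0.
  lra.
Qed.

End Step.
Section Limit.
Variable h0 : Y -> Z.

Definition admissible (h : Y -> Z) := [/\ continuous h, forall y, h (- y) = - h y,
  forall y, A y -> G (h y) & forall y, J (h0 y) <= 0 -> h y = h0 y].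

(** Including c bounds the height below, as the ordering principle requires, and makes the set
    nonempty even if [A] is empty. *)
Definition height (h : Y -> Z) := sup ([set c] `|` [set J (h y) | y in A]).

Lemma heightP h : continuous h -> [/\ c <= height h, forall y, A y -> J (h y) <= height h &
  forall M, c <= M -> (forall y, A y -> J (h y) <= M) -> height h <= M].
Proof.
move=> ch; have ub M : c <= M -> (forall y, A y -> J (h y) <= M) ->
    ubound ([set c] `|` [set J (h y) | y in A]) M.
  by move=> cM HM _ [->//|[y Ay <-]]; exact: HM.
have [M HM] : exists M, forall y, A y -> (J \o h) y <= M.
  apply: compact_ub => // y; apply: continuous_comp; [exact: ch|exact: J_cont].
have hs : has_sup ([set c] `|` [set J (h y) | y in A]).
  split; first by exists c; left.
  exists (Num.max c M); apply: ub; first by rewrite le_max lexx.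
  by move=> y /HM JM; rewrite le_max JM orbT.
split.
- by apply: sup_upper_bound => //; left.
- by move=> y Ay; apply: sup_upper_bound => //; right; exists y.
- by move=> M' cM HM'; apply: ge_sup; [case: hs|exact: ub].
Qed.

(** Maps are ordered by requiring that the uniform displacement, times [lam], be at most the loss of
    height. A maximal map has height c, since otherwise [deformation_step] would give a strictly
    lower map above it. *)
Lemma deformation : admissible h0 ->
  (forall u, G u -> c <= J u -> exists V d, steep u V d) ->
  exists h, admissible h /\ forall y, A y -> J (h y) <= c.
Proof.
move=> adm0 Gst; pose T := {h | admissible h}.
pose Phi (x : T) := height (sval x).
pose le (x x' : T) := forall y, lam * `|sval x' y - sval x y| <= Phi x - Phi x'.
have hP (x : T) : [/\ c <= Phi x, forall y, A y -> J (sval x y) <= Phi x &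
    forall M, c <= M -> (forall y, A y -> J (sval x y) <= M) -> Phi x <= M].
  by apply: heightP; case: (svalP x).
have mono x x' : le x x' -> Phi x' <= Phi x.
  by move=> /(_ 0) H; rewrite -subr_ge0; apply: le_trans H; rewrite mulr_ge0 // ltW.
have [x _ xmax] : exists2 x, le (exist _ h0 adm0) x & forall x', le x x' -> Phi x <= Phi x'.
  apply: (@exists_Phi_maximal R T le Phi c) => //.
  - by move=> x y; rewrite !subrr normr0 mulr0.
  - move=> x1 x2 x3 h12 h23 y; have := h12 y; have := h23 y.
    have : lam * `|sval x3 y - sval x1 y| <=
        lam * (`|sval x3 y - sval x2 y| + `|sval x2 y - sval x1 y|).
      by apply: ler_wpM2l; [exact: ltW|exact: ler_distD].
    rewrite mulrDr; lra.
  - by move=> x; case: (hP x).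
  (* Along an increasing sequence the heights converge, so the maps converge uniformly; their limit
     is the required upper bound. *)
  move=> u uS; pose L := inf (range (Phi \o u)).
  have Lb : has_inf (range (Phi \o u)).
    split; first by exists (Phi (u 0%N)), 0%N.
    by exists c => _ [k _ <-] /=; case: (hP (u k)).
  have LP k : L <= Phi (u k) by apply: ge_inf; [case: Lb|exists k].
  have ukl k l : (k <= l)%N -> le (u k) (u l).
    move=> /subnK <-; elim: (l - k)%N => [|j IH] y.
      by rewrite !subrr normr0 mulr0.
    rewrite addSn; have := IH y; have := uS (j + k)%N y.
    have : lam * `|sval (u (j + k).+1) y - sval (u k) y| <= lam *
       (`|sval (u (j + k).+1) y - sval (u (j + k)%N) y| + `|sval (u (j + k)%N) y - sval (u k) y|).
      by apply: ler_wpM2l; [exact: ltW|exact: ler_distD].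
    rewrite mulrDr; lra.
  have small d : 0 < d -> exists k, (Phi (u k) - L) / lam < d.
    move=> d0; have [|_ [k _ <-] kL] := @inf_adherent _ _ (d * lam) _ Lb.
      by rewrite mulr_gt0.
    by exists k; rewrite ltr_pdivrMr // ltrBlDl.
  have [||//|g [gc gu glim]] := @uniform_limit R Y Z (fun k => sval (u k))
      (fun k => (Phi (u k) - L) / lam).
  - by move=> k; case: (svalP (u k)).
  - move=> k l y kl; rewrite ler_pdivlMr // mulrC.
    by apply: le_trans (ukl _ _ kl y) _; rewrite lerD2l lerN2.
  have lim_eq y z : (forall k, sval (u k) y = z) -> g y = z.
    move=> H; apply/eqP; rewrite -subr_eq0 -normr_le0; apply/ler_addgt0Pr => d d0.
    have [N HN] := glim y d d0; have := HN N (leqnn N).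
    by rewrite H distrC add0r => /ltW.
  have adm : admissible g.
    split=> //.
    - move=> y; apply/eqP; rewrite -subr_eq0 -normr_le0 opprK; apply/ler_addgt0Pr => d d0.
      have d2 : 0 < d / 2 by lra.
      have [N1 H1] := glim y _ d2; have [N2 H2] := glim (- y) _ d2.
      have := H1 (maxn N1 N2) (leq_maxl _ _); have := H2 (maxn N1 N2) (leq_maxr _ _).
      have [_ uo _ _] := svalP (u (maxn N1 N2)); rewrite uo.
      set z := sval _ y; have := ler_distD (- z) (g (- y)) (- g y).
      rewrite [`|g (- y) - - z|]distrC; have -> : - z - - g y = g y - z by rewrite opprK addrC.
      by rewrite opprK [`|g y - z|]distrC; lra.
    - move=> y Ay; apply: contrapT => nG.
      have /nbhs_normP[d d0 Hd] : nbhs (g y) (~` G).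
        by apply: open_nbhs_nbhs; split => //; exact: closed_openC.
      have [N HN] := glim y d d0.
      apply: (Hd (sval (u N) y)); first by rewrite /= distrC HN.
      by have [_ _ + _] := svalP (u N); apply.
    - by move=> y Jy; apply: lim_eq => k; have [_ _ _ ->] := svalP (u k).
  exists (exist _ g adm) => k y /=.
  have PL : Phi (exist _ g adm) <= L.
    have [_ _ PM] := hP (exist _ g adm); apply: PM.
      by apply: lb_le_inf; [case: Lb|move=> _ [j _ <-]; case: (hP (u j))].
    move=> y' Ay'; rewrite leNgt; apply/negP => LJ.
    have [|_ [j _ <-] jL] := @inf_adherent _ _ (J (g y') - L) _ Lb.
      by rewrite subr_gt0.
    rewrite -/L addrC subrK in jL.
    have [d d0 Hd] := continuous_gt J_cont jL; have [N HN] := glim y' d d0.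
    have := Hd _ (HN (maxn N j) (leq_maxl _ _)).
    apply/negP; rewrite -leNgt; have [_ /(_ y' Ay') HJ _] := hP (u (maxn N j)).
    apply: le_trans HJ _; apply: mono; apply: ukl; exact: leq_maxr.
  have := gu k y; rewrite ler_pdivlMr // mulrC => H.
  by apply: le_trans H _; rewrite lerD2l lerN2.
exists (sval x); split; first exact: svalP.
have [cx Jx Mx] := hP x; have [xc xo xG x0] := svalP x.
have [xc'|xc'] := leP (Phi x) c; first by move=> y Ay; exact: le_trans (Jx y Ay) xc'.
have [|h' [t [t0 [hc' ho' hG'] h0' h't [ct Jt]]]] := deformation_step xc xo xG _ xc' Jx.
  by move=> y /xG Gy; exact: Gst.
have adm' : admissible h' by split=> // y Jy; rewrite h0' x0 // -?x0.
have [_ _ Px'] := hP (exist _ h' adm').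
have {}Px' : Phi (exist _ h' adm') <= Phi x - lam * t by apply: Px' => //; lra.
have : Phi x <= Phi (exist _ h' adm').
  apply: xmax => y /=; have : lam * `|h' y - sval x y| <= lam * t.
    by apply: ler_wpM2l; [exact: ltW|exact: h't].
  lra.
have : 0 < lam * t by rewrite mulr_gt0.
lra.
Qed.

End Limit.
End Deformation.

(** * Distance to a set *)

Section DistanceToSet.
Context {R : realType} (Z : normedModType R).
Variable S : set Z.
Hypothesis S0 : S !=set0.

Definition dist_set (u : Z) : R := inf [set `|u - y| | y in S].

Let dist_has_inf u : has_inf [set `|u - y| | y in S].
Proof.
split; first by case: S0 => y Sy; exists `|u - y|, y.
by exists 0 => _ [y _ <-].
Qed.

Lemma dist_set_ge0 u : 0 <= dist_set u.
Proof. by apply: lb_le_inf; [case: (dist_has_inf u)|move=> _ [y _ <-]]. Qed.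

Lemma dist_set_le u y : S y -> dist_set u <= `|u - y|.
Proof. by move=> Sy; apply: ge_inf; [case: (dist_has_inf u)|exists y]. Qed.

Lemma dist_set_lt u e : dist_set u < e -> exists2 y, S y & `|u - y| < e.
Proof.
move=> ue; have [|_ [y Sy <-] uy] := @inf_adherent _ _ (e - dist_set u) _ (dist_has_inf u).
  by rewrite subr_gt0.
by exists y => //; move: uy; rewrite -/(dist_set u) [X in _ < X]addrC subrK.
Qed.

Lemma dist_set_lip u v : dist_set u <= dist_set v + `|u - v|.
Proof.
apply/ler_addgt0Pr => e e0; have [|y Sy vy] := @dist_set_lt v (dist_set v + e).
  by rewrite ltrDl.
have := dist_set_le u Sy; have := ler_distD v u y; lra.
Qed.

Lemma dist_set_continuous : continuous dist_set.
Proof.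
apply/continuousP_norm => x e e0; exists e => // y yx.
have := dist_set_lip x y; have := dist_set_lip y x; rewrite [`|x - y|]distrC.
by rewrite ltr_norml; move: yx; set t := `|y - x| => *; apply/andP; split; lra.
Qed.

Lemma dist_set_mem u : S u -> dist_set u = 0.
Proof.
move=> Su; apply/eqP; rewrite eq_le dist_set_ge0 andbT.
by have := dist_set_le u Su; rewrite subrr normr0.
Qed.

Lemma dist_setN u : (forall y, S y -> S (- y)) -> dist_set (- u) = dist_set u.
Proof.
move=> SN; rewrite /dist_set; congr inf; apply/seteqP; split=> _ [y Sy <-];
  exists (- y); rewrite ?opprK; try exact: SN.
  by rewrite -[RHS]normrN opprD !opprK.
by rewrite -[LHS]normrN opprD !opprK.
Qed.

End DistanceToSet.

(** * Descent directions of a functional of class C^1 *)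

Section C1Functional.
Context {R : realType} (Z : completeNormedModType R).
Variable J : Z -> R.
Hypothesis J_C1 : is_C1 J.

Lemma C1_continuous : continuous J.
Proof. by move=> u; apply: differentiable_continuous; case: J_C1. Qed.

Lemma dual_norm_ub (L : Z -> R) h : `|h| <= 1 -> ((`|L h|)%:E <= dual_norm L)%E.
Proof. by move=> h1; apply: ereal_sup_ubound; exists h. Qed.

Lemma dual_norm_gt u (t : R) : (t%:E < dual_norm ('d J u))%E ->
  exists2 V, `|V| <= 1 & 'd J u V < - t.
Proof.
move=> /ereal_sup_gt[_ [V /= V1 <-]]; rewrite lte_fin => tV.
have [V0|V0] := leP 0 ('d J u V).
  by exists (- V); rewrite ?normrN // linearN ltrN2; move: tV; rewrite ger0_norm.
by exists V => //; move: tV; rewrite ltr0_norm // ltrNr.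
Qed.

Lemma diff_lt_near u V (t : R) : `|V| <= 1 -> 'd J u V < t ->
  exists2 d, 0 < d & forall w, `|w - u| < d -> 'd J w V < t.
Proof.
move=> V1 uV; have [_ /(_ u) cd] := J_C1.
have t0 : 0 < t - 'd J u V by rewrite subr_gt0.
have /cd /nbhs_normP[d d0 Hd] : nbhs (0%E : \bar R) [set x | (x < (t - 'd J u V)%:E)%E].
  apply: open_nbhs_nbhs; split => //; exact: lray_open.
exists d => // w wu; have := Hd w; rewrite /= distrC => /(_ wu) H.
have := le_lt_trans (dual_norm_ub (fun h => 'd J w h - 'd J u h) V1) H.
by rewrite lte_fin => /(le_lt_trans (ler_norm _)); lra.
Qed.

Lemma is_derive_along w V (x : R) :
  is_derive x 1 (fun s : R => J (w + s *: V)) ('d J (w + x *: V) V).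
Proof.
have [dJ _] := J_C1; have dv : derivable J (w + x *: V) V.
  exact: diff_derivable.
have e : (fun h : R => h^-1 *: (((fun s : R => J (w + s *: V)) \o shift x) (h *: 1) -
    J (w + x *: V))) = (fun h => h^-1 *: ((J \o shift (w + x *: V)) (h *: V) - J (w + x *: V))).
  apply/funext => h /=; congr (_ *: (J _ - _)).
  by rewrite [h *: 1]mulr1 scalerDl addrCA.
apply: DeriveDef; first by rewrite /derivable e.
by rewrite /derive e -deriveE.
Qed.

(** Mean value theorem along the segment; halving the radius keeps the whole segment where the
    derivative along V is below [- t]. *)
Lemma decrease_near u V (t : R) : `|V| <= 1 -> 'd J u V < - t ->
  exists2 d, 0 < d & forall w s, `|w - u| < d -> 0 <= s -> s < d ->
    J (w + s *: V) <= J w - t * s.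
Proof.
move=> V1 uV; have [d d0 Hd] := diff_lt_near V1 uV.
exists (d / 2); first by lra.
move=> w s wu s0 sd; have [->|s0'] := eqVneq s 0.
  by rewrite scale0r addr0 mulr0 subr0.
have {s0'} s0 : 0 < s by rewrite lt_neqAle eq_sym s0' s0.
have cf : {within `[0, s], continuous (fun s : R => J (w + s *: V))}.
  apply: continuous_subspaceT => x.
  apply: differentiable_continuous; apply/derivable1_diffP.
  by have [] := is_derive_along w V x.
have [x + xE] := MVT s0 (fun x _ => is_derive_along w V x) cf.
rewrite in_itv /= => /andP[x0 xs].
have xV : 'd J (w + x *: V) V < - t.
  apply: Hd; rewrite addrAC; apply: le_lt_trans (ler_normD _ _) _.
  have : `|x *: V| <= s.
    rewrite normrZ gtr0_norm // -[leRHS]mulr1; apply: ler_pM => //; exact: ltW.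
  lra.
have : 'd J (w + x *: V) V * (s - 0) <= - t * s.
  rewrite subr0; apply: ler_wpM2r; exact: ltW.
by rewrite -xE scale0r addr0; lra.
Qed.

Lemma not_critical_near u : ~ critical_set J u ->
  exists2 d, 0 < d & exists2 t : R, 0 < t & forall w, `|w - u| < d ->
    (t%:E < dual_norm ('d J w))%E.
Proof.
move=> /existsNP[h /eqP hu].
have h0 : h != 0 by apply: contraNneq hu => ->; rewrite linear0.
have : exists2 V, `|V| <= 1 & 'd J u V < 0.
  have nh : 0 < `|h| by rewrite normr_gt0.
  have n1 (k : R) : `|k| = 1 -> `|(k * `|h|^-1) *: h| <= 1.
    by move=> k1; rewrite normrZ normrM k1 mul1r normfV normr_id mulVf // gt_eqF.
  have [hn|hp|he] := ltgtP ('d J u h) 0; last by rewrite he eqxx in hu.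
    exists ((1 * `|h|^-1) *: h); first by apply: n1; rewrite normr1.
    by rewrite linearZ /= mul1r pmulr_rlt0 // invr_gt0.
  exists ((- 1 * `|h|^-1) *: h); first by apply: n1; rewrite normrN normr1.
  by rewrite linearZ /= mulN1r scaleNr oppr_lt0; apply: mulr_gt0 => //; rewrite invr_gt0.
move=> [V V1 uV]; have [|d d0 Hd] := @diff_lt_near u V ('d J u V / 2) V1; first by lra.
exists d => //; exists (- ('d J u V / 2)); first by lra.
move=> w /Hd wV; apply: lt_le_trans (dual_norm_ub _ V1).
rewrite lte_fin; apply: lt_le_trans (_ : - 'd J w V <= _); first by rewrite ltrN2.
by rewrite -normrN ler_norm.
Qed.

End C1Functional.

Section StripDeformation.
Context {R : realType} (U : normedModType R) (Z : completeNormedModType R).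
Variable J : Z -> R.
Hypothesis J_C1 : is_C1 J.
Hypothesis J_even : forall u, J (- u) = J u.

(* The penalty tau * dist(u, S) keeps the deformation close to S: where the
   slope exceeds 2 tau, descending J outweighs moving away from S. *)
Lemma strip_deformation (S : set Z) (A : set U) (h0 : U -> Z) (c e tau tau' eta : R) :
  0 < e -> e < c -> 0 < tau -> 0 < tau' -> e *+ 2 < tau * eta ->
  S !=set0 -> (forall u, S u -> S (- u)) ->
  (forall u, dist_set S u < eta -> `|J u - c| <= e ->
     ((tau *+ 2)%:E < dual_norm ('d J u))%E \/
     nbhs u S /\ (tau'%:E < dual_norm ('d J u))%E) ->
  compact A -> continuous h0 -> (forall y, h0 (- y) = - h0 y) ->
  (forall y, A y -> S (h0 y) /\ J (h0 y) <= c + e) ->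
  exists h, [/\ continuous h, forall y, h (- y) = - h y,
    forall y, J (h0 y) <= 0 -> h y = h0 y & forall y, A y -> J (h y) <= c - e].
Proof.
move=> e0 ec tau0 tau'0 e2 S0 SN HS cA h0c h0o h0A.
pose D := dist_set S; pose G := [set u | J u + tau * D u <= c + e].
have D0 u : 0 <= D u := dist_set_ge0 S0 u.
have Jc := C1_continuous J_C1.
have Gc : closed G.
  have -> : G = (fun u => J u + tau * D u) @^-1` [set t | t <= c + e] by [].
  apply: preimage_closed; last exact: closed_le.
  move=> u _; apply: cvgD; first exact: Jc.
  by apply: cvgM; [exact: cvg_cst|exact: dist_set_continuous].
have GN u : G u -> G (- u) by rewrite /G /= J_even /D dist_setN.
have JG u : G u -> J u <= c + e.
  move=> Gu; apply: le_trans Gu; rewrite lerDl mulr_ge0 //; exact: ltW.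
pose lam := Num.min tau tau'.
have lam0 : 0 < lam by rewrite lt_min tau0.
have steepG u : G u -> c - e <= J u -> exists V d, steep J G lam u V d.
  (* Between the levels [c - e] and [c + e] the penalty is at most [2 e], which is less than
     [tau * eta]. *)
  move=> Gu cu; have De : D u < eta.
    rewrite -(ltr_pM2l tau0); apply: le_lt_trans e2; rewrite mulr2n.
    by move: Gu; rewrite /G /=; lra.
  have Ju : `|J u - c| <= e by have := JG u Gu; rewrite ler_norml => ?; apply/andP; split; lra.
  have [slope|[uS slope]] := HS u De Ju.
    (* A move of length t lowers J by [2 tau t] and raises the penalty by at most [tau t]. *)
    have [V V1 uV] := dual_norm_gt slope; have [d d0 Hd] := decrease_near J_C1 V1 uV.
    exists V, d; split=> // w t Gw wu t0 td; have Jw := Hd w t wu t0 td.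
    have lt : lam * t <= tau * t by apply: ler_wpM2r => //; rewrite ge_min lexx.
    have tt : 0 <= tau * t by rewrite mulr_ge0 // ltW.
    have Dw : D (w + t *: V) <= D w + t.
      apply: le_trans (dist_set_lip S0 _ w) _; rewrite lerD2l addrAC subrr add0r.
      by rewrite normrZ ger0_norm // -[leRHS]mulr1; apply: ler_wpM2l.
    have {}Dw : tau * D (w + t *: V) <= tau * D w + tau * t.
      by rewrite -mulrDr ler_pM2l.
    rewrite mulr2n in Jw; move: Gw; rewrite /G /=; split; last by lra.
    lra.
  (* Inside S the penalty vanishes all along a short move, so any descent of J preserves [G]. *)
  have [V V1 uV] := dual_norm_gt slope; have [d d0 Hd] := decrease_near J_C1 V1 uV.
  have /nbhs_normP[d' d'0 Hd'] := uS.
  exists V, (Num.min d (d' / 2)); split=> //; first by rewrite lt_min d0 divr_gt0.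
  move=> w t Gw; rewrite !lt_min => /andP[wu wu'] t0 /andP[td td'].
  have Jw := Hd w t wu t0 td.
  have lt : lam * t <= tau' * t by apply: ler_wpM2r => //; rewrite ge_min lexx orbT.
  have tt : 0 <= tau' * t by rewrite mulr_ge0 // ltW.
  split; last by lra.
  rewrite /G /= /D dist_set_mem //; first by have := JG w Gw; lra.
  apply: Hd'; rewrite /= distrC addrAC; apply: le_lt_trans (ler_normD _ _) _.
  have : `|t *: V| <= t by rewrite normrZ ger0_norm // -[leRHS]mulr1; apply: ler_wpM2l.
  lra.
have ce0 : 0 < c - e by rewrite subr_gt0.
have adm : admissible J G A h0 h0.
  split=> // y /h0A[Sy Jy]; rewrite /G /= /D dist_set_mem // mulr0 addr0 //.
have [h [[hc ho _ hJ] hA]] :=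
  deformation Jc J_even Gc GN ce0 lam0 cA adm steepG.
by exists h; split.
Qed.

End StripDeformation.

(** * Consequences of PS-attraction *)

Section PalaisSmale.
Context {R : realType} (Z : completeNormedModType R).
Variable J : Z -> R.
Hypothesis J_C1 : is_C1 J.
Hypothesis J_PS : PS_attracting J.
Variable L : R.
Hypothesis L_sep : (L%:E < separation (critical_set J))%E.

Definition almost_critical (c e tau : R) : set Z :=
  [set u | `|J u - c| <= e /\ (dual_norm ('d J u) <= tau%:E)%E].

Lemma dual_norm_ge0 (F : Z -> R) : (0 <= dual_norm F)%E.
Proof.
apply: (@le_trans _ _ (`|F 0|)%:E); first by rewrite lee_fin.
by apply: ereal_sup_ubound; exists 0 => //=; rewrite normr0.
Qed.

Lemma PS_sequenceI (v : nat -> Z) (c : R) :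
  (forall k, almost_critical c k.+1%:R^-1 k.+1%:R^-1 (v k)) -> PS_sequence J v.
Proof.
move=> H; split.
  exists c; apply/cvgrPdistC_lt => e e0; have [N HN] := @invS_small R e e0.
  by exists N => // k Nk; apply: le_lt_trans (HN k Nk); case: (H k).
apply: (@squeeze_cvge _ _ _ _ (cst 0%E) _ (fun k => (k.+1%:R^-1)%:E)).
- by apply: nearW => k; rewrite dual_norm_ge0; case: (H k).
- exact: cvg_cst.
- apply: cvg_EFin; first exact: nearW.
  exact: cvg_harmonic.
Qed.

(** Distances at least r exclude the first alternative of PS-attraction; distances at most L, below
    the separation of the critical points, exclude the second. *)
Lemma PS_close (v w : nat -> Z) (r : R) : 0 < r ->
  PS_sequence J v -> PS_sequence J w ->
  (forall k, r <= `|v k - w k|) -> (forall k, `|v k - w k| <= L) -> False.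
Proof.
move=> r0 PSv PSw rd dL; have [d0|dk] := J_PS PSv PSw.
  have /cvgrPdistC_lt /(_ r r0) [N _ /(_ N (leqnn N))] := d0.
  by rewrite /= subr0 normr_id ltNge rd.
have : (limn_esup (fun n => (`|v n - w n|)%:E) <= L%:E)%E.
  rewrite limn_esup_lim; apply: lime_le; first exact: is_cvg_esups.
  apply: nearW => k; apply: ge_ereal_sup => _ [j _ <-]; by rewrite lee_fin.
by move=> /(le_trans dk); rewrite leNgt L_sep.
Qed.

(** Otherwise pairs at distance between r and L, with tolerances tending to 0, would form two
    sequences forbidden by [PS_close]. *)
Lemma almost_critical_clusters (c r : R) : 0 < r ->
  exists2 e, 0 < e & forall v w, almost_critical c e e v -> almost_critical c e e w ->
    `|v - w| < r \/ L < `|v - w|.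
Proof.
move=> r0; apply: contrapT => H.
have /choice[vw vwP] : forall k : nat, exists vw : Z * Z,
    [/\ almost_critical c k.+1%:R^-1 k.+1%:R^-1 vw.1,
        almost_critical c k.+1%:R^-1 k.+1%:R^-1 vw.2,
        r <= `|vw.1 - vw.2| & `|vw.1 - vw.2| <= L].
  move=> k; apply: contrapT => Hk; apply: H; exists k.+1%:R^-1; first by rewrite invr_gt0.
  move=> v w cv cw; have [|vr] := ltP `|v - w| r; first by left.
  have [Lv|vL] := ltP L `|v - w|; first by right.
  by exfalso; apply: Hk; exists (v, w); split.
apply: (@PS_close (fun k => (vw k).1) (fun k => (vw k).2) r) => //.
- by apply: (@PS_sequenceI _ c) => k; case: (vwP k).
- by apply: (@PS_sequenceI _ c) => k; case: (vwP k).
- by move=> k; case: (vwP k).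
- by move=> k; case: (vwP k).
Qed.

Lemma almost_criticalW (c e e' : R) u : e <= e' ->
  almost_critical c e e u -> almost_critical c e' e' u.
Proof.
move=> ee [h1 h2]; split; first exact: le_trans ee.
by apply: le_trans h2 _; rewrite lee_fin.
Qed.

Lemma invS_le (k l : nat) : (k <= l)%N -> (l.+1%:R^-1 <= k.+1%:R^-1 :> R).
Proof. by move=> kl; rewrite lef_pV2 ?posrE ?ltr0n // ler_nat ltnS. Qed.

(** If v were not Cauchy, [PS_close] would apply to v and a reindexing of v staying at distance at
    least d from it. The limit is critical because slopes are bounded below near any other point. *)
Lemma PS_condition (v : nat -> Z) (c : R) :
  (forall k, almost_critical c k.+1%:R^-1 k.+1%:R^-1 (v k)) ->
  (forall k l, `|v k - v l| <= L) ->
  exists2 l, critical_set J l & forall e, 0 < e -> exists N, forall k, (N <= k)%N -> `|v k - l| < e.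
Proof.
move=> vc vL; have [d d0|l lP] := @complete_seq R Z v.
  apply: contrapT => H.
  have /choice[f fP] : forall N, exists k, (N <= k)%N /\ d <= `|v k - v N|.
    move=> N; apply: contrapT => HN; apply: H; exists N => k Nk.
    by rewrite ltNge; apply/negP => dk; apply: HN; exists k.
  apply: (@PS_close (v \o f) v d) => //.
  - apply: (@PS_sequenceI _ c) => k; have [kf _] := fP k.
    exact: almost_criticalW (invS_le kf) (vc (f k)).
  - exact: PS_sequenceI vc.
  - by move=> k; case: (fP k).
  - by move=> k; exact: vL.
exists l => //; apply: contrapT => /(not_critical_near J_C1)[d d0 [t t0 Ht]].
have [N1 H1] := lP d d0; have [N2 H2] := invS_small t0.
have := Ht _ (H1 (maxn N1 N2) (leq_maxl _ _)).
have [_ H] := vc (maxn N1 N2); apply/negP; rewrite -leNgt; apply: le_trans H _.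
by rewrite lee_fin ltW // H2 // leq_maxr.
Qed.

(** Otherwise almost critical points exist near K. Compactness of K brings a subsequence within
    mutual distance L, and [PS_condition] yields a critical point with value within e of c. *)
Lemma PS_tube (K : set Z) (c e r : R) : compact K -> K !=set0 -> 0 < e -> r *+ 2 < L ->
  (forall u, critical_set J u -> e < `|J u - c|) ->
  exists2 tau, 0 < tau & forall u, dist_set K u < r -> `|J u - c| <= e ->
    (tau%:E < dual_norm ('d J u))%E.
Proof.
move=> cK K0 e0 rL noc; apply: contrapT => H.
have /choice[u uP] : forall k : nat, exists u,
    [/\ `|J u - c| <= e, (dual_norm ('d J u) <= (k.+1%:R^-1)%:E)%E & dist_set K u < r].
  move=> k; apply: contrapT => Hk; apply: H; exists k.+1%:R^-1; first by rewrite invr_gt0.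
  by move=> u uy Ju; rewrite ltNge; apply/negP => du; apply: Hk; exists u.
have /choice[y yP] : forall k : nat, exists y, K y /\ `|u k - y| < r.
  by move=> k; have [_ _ /(dist_set_lt K0)[y Ky uy]] := uP k; exists y.
have [x _ cx] := compact_seq cK (fun k => proj1 (yP k)).
(* Two terms near K are then at most [2 r] plus twice this gap apart, that is, at most L. *)
have gap : 0 < (L - r *+ 2) / 2 by rewrite divr_gt0 // subr_gt0.
have /choice[phi phiP] : forall k : nat, exists l, (k <= l)%N /\ `|y l - x| < (L - r *+ 2) / 2.
  by move=> k; have [l kl lx] := cx _ k gap; exists l.
have J_itv k : `[c - e, c + e]%classic (J (u (phi k))).
  rewrite /= in_itv /=; have [] := uP (phi k).
  by rewrite ler_norml => ? _ _; apply/andP; split; lra.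
have [c' _ cc'] := compact_seq (@segment_compact _ _ _) J_itv.
have /choice[psi psiP] : forall k : nat, exists l, (k <= l)%N /\
    `|J (u (phi l)) - c'| < k.+1%:R^-1.
  by move=> k; have [|l kl lx] := cc' k.+1%:R^-1 k; [by rewrite invr_gt0|exists l].
pose v k := u (phi (psi k)).
have [|k l|z zc vz] := @PS_condition v c'.
- move=> k; have [k1 k2] := psiP k; split; first exact: ltW.
  have [_ dk _] := uP (phi (psi k)); apply: le_trans dk _; rewrite lee_fin.
  by apply: invS_le; apply: leq_trans k1 _; case: (phiP (psi k)).
- have [_ kx] := phiP (psi k); have [_ lx] := phiP (psi l).
  have [_ hk] := yP (phi (psi k)); have [_ hl] := yP (phi (psi l)).
  rewrite -/(v k) in hk; rewrite -/(v l) in hl; rewrite mulr2n in kx lx.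
  have := ler_distD x (v k) (v l).
  have := ler_distD (y (phi (psi k))) (v k) x.
  have := ler_distD (y (phi (psi l))) (v l) x.
  by rewrite [`|x - v l|]distrC; lra.
have /continuousP_norm /(_ z) cJ := C1_continuous J_C1.
have [d d0 Hd] := cJ _ (eqbRL (subr_gt0 _ _) (noc z zc)).
have [N HN] := vz d d0; have := Hd _ (HN N (leqnn N)).
have [Jv _ _] := uP (phi (psi N)); rewrite -/(v N) in Jv.
have := ler_distD (J (v N)) (J z) c; rewrite [`|J z - J (v N)|]distrC; lra.
Qed.

End PalaisSmale.

(** * An odd function that is nonzero near antipodal clusters *)

Section OddSeparation.
Context {R : realType} (Z : completeNormedModType R).

(* chi is built from one cluster in each pair {C, -C}, chosen by rep. *)
Lemma odd_separation (N : set Z) (r L d : R) : 0 < r -> r *+ 2 <= L -> d *+ 2 <= L ->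
  (forall v, N v -> N (- v)) -> (forall v, N v -> r <= `|v|) ->
  (forall v w, N v -> N w -> `|v - w| < r \/ L < `|v - w|) ->
  exists chi : Z -> R, [/\ continuous chi, forall u, chi (- u) = - chi u &
    forall u v, chi u = 0 -> N v -> d <= `|u - v|].
Proof.
move=> r0 rL dL NN Nr NL.
have [->|/set0P[v0 Nv0]] := eqVneq N set0.
  by exists (cst 0); split=> [u|u|//]; [exact: cvg_cst|rewrite /cst oppr0].
have close v w : N v -> N w -> `|v - w| <= L -> `|v - w| < r.
  by move=> Nv Nw vL; case: (NL v w Nv Nw) => //; rewrite ltNge vL.
have close2 v w z : N v -> N w -> `|v - z| < r -> `|z - w| < r -> `|v - w| < r.
  move=> Nv Nw vz zw; apply: close => //; rewrite mulr2n in rL.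
  have := ler_distD z v w; lra.
(* The union of the cluster of v and that of [- v]. As a set it is the same for all points of the
   pair, so the choice [rep] depends only on the pair. *)
pose S v := [set w | N w /\ (`|w - v| < r \/ `|w - - v| < r)].
have SN v : S (- v) = S v.
  by rewrite /S opprK; apply/seteqP; split=> w [Nw [h|h]]; split=> //; [right|left|right|left].
have Sclose v w : N v -> N w -> `|v - w| < r -> S v = S w.
  have sub v' w' : N v' -> N w' -> `|v' - w'| < r -> S v' `<=` S w'.
    move=> Nv Nw vw z [Nz [h|h]]; split=> //; [left|right].
      exact: (close2 z w' v').
    apply: (close2 z (- w') (- v')) => //; first exact: NN.
    by rewrite opprK addrC distrC.
  move=> Nv Nw vw; apply/seteqP; split; apply: sub => //; by rewrite distrC.
pose rep v := xget 0 (S v).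
have repS v : N v -> S v (rep v).
  by move=> Nv; apply: xgetPex; exists v; split=> //; left; rewrite subrr normr0.
pose P := [set v | N v /\ `|v - rep v| < r].
have PN v : N v -> P v \/ P (- v).
  move=> Nv; have [_ [h|h]] := repS v Nv; [left|right]; split.
  - by [].
  - by rewrite distrC.
  - exact: NN.
  - by rewrite /rep SN distrC.
(* If v were close to [- w], both points would share a representative, so v would be close to w as
   well and 2 v shorter than [2 r]. *)
have PP v w : P v -> P w -> L < `|v + w|.
  move=> [Nv vr] [Nw wr]; rewrite ltNge; apply/negP => vwL.
  have vw : `|v - - w| < r by apply: close; [|exact: NN|rewrite opprK].
  have e : rep w = rep v by rewrite /rep (Sclose v (- w)) ?SN //; exact: NN.
  have [Nrep _] := repS v Nv.
  have vw' : `|v - w| < r by apply: (close2 v w (rep v)) => //; rewrite distrC -e.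
  have : `|v *+ 2| < r *+ 2.
    have -> : v *+ 2 = (v - - w) + (v - w) by rewrite opprK addrACA subrr addr0 mulr2n.
    by rewrite [ltRHS]mulr2n; apply: le_lt_trans (ler_normD _ _) _; exact: ltrD.
  by rewrite normrMn ltrMn2r /= ltNge Nr //.
have P0 : P !=set0 by case: (PN v0 Nv0) => h; [exists v0|exists (- v0)].
pose D := dist_set P.
have Dc : continuous (fun u => Num.max 0 (d - D u)).
  apply: continuous_maxr => u; first exact: cvg_cst.
  by apply: cvgB; [exact: cvg_cst|exact: dist_set_continuous].
exists (fun u => Num.max 0 (d - D u) - Num.max 0 (d - D (- u))); split.
- by move=> u; apply: cvgB; [exact: Dc|exact: (continuousN_arg Dc)].
- by move=> u; rewrite [RHS]opprB [- - u]opprK.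
(* Near a point of N exactly one of the two bumps is positive, so their difference cannot vanish. *)
have near u : D u < d -> D (- u) < d -> False.
  move=> /(dist_set_lt P0)[v Pv uv] /(dist_set_lt P0)[w Pw uw].
  have := PP v w Pv Pw; apply/negP; rewrite -leNgt; apply: le_trans dL.
  have -> : v + w = (v - u) - (- u - w).
    by rewrite opprB opprK [w + u]addrC addrA subrK.
  rewrite mulr2n; apply: le_trans (ler_normB _ _) _.
  by apply: lerD; [rewrite distrC; exact: ltW|exact: ltW].
have both u : Num.max 0 (d - D u) - Num.max 0 (d - D (- u)) = 0 -> D u < d -> False.
  move=> /eqP; rewrite subr_eq0 => /eqP e Du; apply: (near u Du).
  have : 0 < Num.max 0 (d - D u) by rewrite lt_max subr_gt0 Du orbT.
  by rewrite e lt_max ltxx /= subr_gt0.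
move=> u v chi0 Nv; rewrite leNgt; apply/negP => uv.
have [Pv|Pv] := PN v Nv.
  by apply: (both u chi0); exact: le_lt_trans (dist_set_le P0 _ Pv) uv.
apply: (both (- u)).
  by rewrite [- - u]opprK -[LHS]opprB chi0 oppr0.
apply: le_lt_trans (dist_set_le P0 _ Pv) _.
by rewrite -opprD normrN.
Qed.

End OddSeparation.

Section EvenFunctional.
Context {R : realType} (Z : completeNormedModType R) (J : Z -> R).
Hypothesis J_C1 : is_C1 J.
Hypothesis J_even : forall u, J (- u) = J u.

Lemma diffN_even u h : 'd J (- u) h = - 'd J u h.
Proof.
have e : (fun s : R => J (- u + s *: h)) = (fun s : R => J (u + s *: - h)).
  by apply/funext => s; rewrite -J_even opprD opprK scalerN.
have [_ d1] := is_derive_along J_C1 (- u) h 0.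
have [_ d2] := is_derive_along J_C1 u (- h) 0.
by rewrite !scale0r !addr0 in d1 d2; rewrite -d1 e d2 linearN.
Qed.

Lemma almost_criticalN (c e tau : R) u :
  almost_critical J c e tau u -> almost_critical J c e tau (- u).
Proof.
move=> [h1 h2]; split; first by rewrite J_even.
suff -> : dual_norm ('d J (- u)) = dual_norm ('d J u) by [].
rewrite /dual_norm; congr ereal_sup; apply/eq_imagel => h _.
by rewrite diffN_even normrN.
Qed.

End EvenFunctional.

(** * The minimax levels *)

Lemma lipschitz_continuous (R : realType) (U V : normedModType R) (f : U -> V) (k : R) :
  (forall x y, `|f y - f x| <= k * `|y - x|) -> continuous f.
Proof.
move=> H; apply/continuousP_norm => x e e0; exists (e / (`|k| + 1)).
  by rewrite divr_gt0 // ltr_wpDl.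
move=> y; rewrite ltr_pdivlMr ?ltr_wpDl // => yx; apply: le_lt_trans (H x y) _.
apply: le_lt_trans yx; rewrite mulrC ler_wpM2l //.
by apply: le_trans (ler_norm _) _; rewrite lerDl.
Qed.

(** * Finite-dimensional complements of closed subspaces *)

Section LinearAlgebra.
Context {R : realType} (Z : normedModType R).

Lemma subspaceP (A : set Z) : is_subspace A ->
  [/\ A 0, forall u v, A u -> A v -> A (u + v) & forall (a : R) u, A u -> A (a *: u)].
Proof.
move=> [/set_mem A0 lA]; have lc (a : R) u v : A u -> A v -> A (a *: u + v).
  by move=> Au Av; apply/set_mem; apply: lA; apply/mem_set.
split=> // [u v Au Av|a u Au]; first by rewrite -[u]scale1r; exact: lc.
by rewrite -[_ *: _]addr0; exact: lc.
Qed.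

Lemma subspace0 : is_subspace [set 0 : Z].
Proof.
split; first exact/mem_set.
by move=> a u v /set_mem /= -> /set_mem /= ->; apply/mem_set; rewrite /= scaler0 addr0.
Qed.

Definition lincomb n (b : 'I_n -> Z) (c : 'rV[R]_n) : Z := \sum_i c ord0 i *: b i.

Lemma lincombD n (b : 'I_n -> Z) c c' : lincomb b (c + c') = lincomb b c + lincomb b c'.
Proof. by rewrite /lincomb -big_split; apply: eq_bigr => i _; rewrite mxE scalerDl. Qed.

Lemma lincombZ n (b : 'I_n -> Z) a c : lincomb b (a *: c) = a *: lincomb b c.
Proof. by rewrite /lincomb scaler_sumr; apply: eq_bigr => i _; rewrite mxE scalerA. Qed.

Lemma lincombN n (b : 'I_n -> Z) c : lincomb b (- c) = - lincomb b c.
Proof. by rewrite -scaleN1r lincombZ scaleN1r. Qed.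

Lemma lincomb_continuous n (b : 'I_n -> Z) : continuous (lincomb b).
Proof.
apply: (@lipschitz_continuous _ _ _ _ (\sum_i `|b i|)) => x y.
rewrite -lincombN -lincombD mulr_suml; apply: le_trans (ler_norm_sum _ _ _) _.
apply: ler_sum => i _; rewrite normrZ mulrC ler_wpM2l //; exact: rV_le_norm.
Qed.

Lemma dist_set_gt0 (S : set Z) u : S !=set0 -> closed S -> ~ S u -> 0 < dist_set S u.
Proof.
move=> S0 cS nu; have /nbhs_normP[d d0 Hd] : nbhs u (~` S).
  by apply: open_nbhs_nbhs; split => //; exact: closed_openC.
apply: lt_le_trans d0 _; rewrite leNgt; apply/negP => /(dist_set_lt S0)[y Sy uy].
exact: (Hd y uy Sy).
Qed.

(** The distance to [A] is positive on the compact image of the unit sphere, hence bounded below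
    there; homogeneity does the rest. *)
Lemma closed_complement_bound (A : set Z) n (b : 'I_n -> Z) :
  is_subspace A -> closed A -> (forall c, A (lincomb b c) -> c = 0) ->
  exists2 m, 0 < m & forall z c, A z -> m * `|c| <= `|z + lincomb b c|.
Proof.
move=> /subspaceP[A0 AD AZ] cA indep; have Ane : A !=set0 by exists 0.
have cS : compact [set c : 'rV[R]_n | `|c| = 1].
  apply: (subclosed_compact _ (@compact_rV_ball R n 1)) => [|c /= ->//].
  have -> : [set c : 'rV[R]_n | `|c| = 1] = (fun c => `|c|) @^-1` [set 1] by [].
  by apply: preimage_closed => [c _|]; [exact: norm_continuous|exact: closed_eq].
have [||m m0 Hm] := compact_lb_gt0 (f := dist_set A \o lincomb b) _ cS.
- move=> c; apply: continuous_comp; first exact: lincomb_continuous.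
  exact: dist_set_continuous.
- move=> c /= c1; apply: dist_set_gt0 => // /indep c0.
  by move: c1; rewrite c0 normr0 => /eqP; rewrite eq_sym oner_eq0.
exists m => // z c Az; have [->|c0] := eqVneq c 0; first by rewrite normr0 mulr0.
have nc : 0 < `|c| by rewrite normr_gt0.
rewrite -ler_pdivlMr //; have c1 : `|(`|c|^-1 *: c : 'rV[R]_n)| = 1.
  by rewrite normrZ normfV normr_id mulVf // gt_eqF.
apply: le_trans (Hm _ c1) _; rewrite /= lincombZ.
apply: le_trans (dist_set_le Ane _ (AZ (- `|c|^-1) _ Az)) _.
by rewrite scaleNr opprK -scalerDr normrZ normfV normr_id mulrC addrC.
Qed.

(** Coordinates modulo A: uniqueness makes them odd, and [closed_complement_bound] makes them
    Lipschitz. *)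
Lemma projection_coordinates (A : set Z) n (b : 'I_n -> Z) :
  is_subspace A -> closed A -> (forall c, A (lincomb b c) -> c = 0) ->
  (forall u, exists2 c, A (u - lincomb b c) & True) ->
  exists Q : Z -> 'rV[R]_n, [/\ continuous Q, forall u, Q (- u) = - Q u &
    forall u, Q u = 0 -> A u].
Proof.
move=> sA cA indep span; have [m m0 Hm] := closed_complement_bound sA cA indep.
have [A0 AD AZ] := subspaceP sA; have AN u : A u -> A (- u).
  by rewrite -scaleN1r; exact: AZ.
have /choice[Q QP] : forall u, exists c, A (u - lincomb b c).
  by move=> u; have [c Ac _] := span u; exists c.
exists Q; split.
- apply: (@lipschitz_continuous _ _ _ _ m^-1) => x y.
  rewrite mulrC ler_pdivlMr // mulrC.
  have Ad : A ((y - lincomb b (Q y)) - (x - lincomb b (Q x))) by apply: AD => //; exact: AN.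
  apply: le_trans (Hm _ (Q y - Q x) Ad) _; rewrite lincombD lincombN.
  by rewrite opprB addrAC subrKA subrKA.
- move=> u; apply/eqP; rewrite -subr_eq0 opprK; apply/eqP/indep.
  have := AD _ _ (QP u) (QP (- u)).
  by rewrite addrACA subrr add0r -opprD -lincombD => /AN; rewrite opprK addrC.
- by move=> u Qu; have := QP u; rewrite Qu -(scale0r 0) lincombZ scale0r subr0.
Qed.

End LinearAlgebra.

(** The list of functions is padded with zero functions up to one less than the dimension. *)
Lemma odd_zero_lt (R : realType) (p a : nat) (f : 'I_p -> 'rV[R]_a -> R)
    (s : 'rV[R]_a -> R) (r : R) : (p < a)%N ->
  (forall i, continuous (f i)) -> (forall i y, f i (- y) = - f i y) ->
  continuous s -> (forall y, s (- y) = s y) -> s 0 < 0 ->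
  (forall y, r <= `|y| -> 0 < s y) ->
  exists y, (forall i, f i y = 0) /\ s y = 0.
Proof.
case: a f s => // n f s pn fc fo sc se s0 sr.
pose f' (i : 'I_n) y := if insub (i : nat) is Some j then f j y else 0.
have [||y [fy sy]] := @odd_zero R n f' s r _ _ sc se s0 sr.
- move=> i; rewrite /f'; case: insub => [j|]; [exact: fc|exact: cst_continuous].
- by move=> i y; rewrite /f'; case: insub => [j|]; rewrite ?fo ?oppr0.
exists y; split=> // i; have := fy (widen_ord (pn : (p <= n)%N) i).
rewrite /f' (insubT (fun k => k < p)%N (ltn_ord i)) /= => <-.
by congr (f _ y); exact: val_inj.
Qed.

Lemma finite_gap (R : realType) (A : set R) (c : R) : finite_set A -> ~ A c ->
  exists2 e : R, 0 < e & forall x, A x -> e < `|x - c|.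
Proof.
move=> fA nAc; have cA : closed A.
  by apply: compact_closed; [exact: Rhausdorff|exact: finite_compact].
have /nbhs_normP[d d0 Hd] : nbhs c (~` A).
  by apply: open_nbhs_nbhs; split => //; exact: closed_openC.
exists (d / 2); first by rewrite divr_gt0.
move=> x Ax; rewrite ltNge; apply/negP => xd; apply: (Hd x) => //=.
by rewrite distrC; apply: le_lt_trans xd _; rewrite ltr_pdivrMr // ltr_pMr // ltr1n.
Qed.

Lemma continuous_normB (R : realType) (U V : normedModType R) (h : U -> V) (c : R) :
  continuous h -> continuous (fun y => `|h y| - c).
Proof. by move=> hc y; apply: cvgB; [apply: cvg_norm; exact: hc|exact: cvg_cst]. Qed.

Section Minimax.
Context {R : realType} (Z : completeNormedModType R).
Variable J : Z -> R.
Hypothesis J_C1 : is_C1 J.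
Hypothesis J_even : forall u, J (- u) = J u.
Hypothesis J0 : J 0 = 0.
Hypothesis J_PS : PS_attracting J.
Hypothesis J_sep : (0 < separation (critical_set J))%E.
Hypothesis J_fin : finite_set (J @` critical_set J).
(** In the application [iota] parametrises the sum of Z^- and Z_m, and [Q] gives the coordinates of
    the Z^- component, so that [link] is the bound on the sphere of Z^+. *)
Variables (a k : nat) (iota : 'rV[R]_a -> Z) (Q : Z -> 'rV[R]_k) (rho alpha r : R).
Hypothesis Q_cont : continuous Q.
Hypothesis Q_odd : forall u, Q (- u) = - Q u.
Hypothesis iota_cont : continuous iota.
Hypothesis iota_odd : forall y, iota (- y) = - iota y.
Hypothesis rho_gt0 : 0 < rho.
Hypothesis alpha_gt0 : 0 < alpha.
Hypothesis link : forall u, Q u = 0 -> `|u| = rho -> alpha <= J u.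
Hypothesis r_gt0 : 0 < r.
Hypothesis iota_far : forall y, r <= `|y| -> J (iota y) <= 0 /\ rho < `|iota y|.

(* The points where one of the j odd functions g does not vanish form a set of
   genus at most j. *)
Definition reachable (j : nat) (b : R) := exists (h : 'rV[R]_a -> Z) (g : 'I_j -> 'rV[R]_a -> R),
  [/\ continuous h /\ (forall y, h (- y) = - h y),
      forall i, continuous (g i), forall i y, g i (- y) = - g i y,
      forall y, r <= `|y| -> h y = iota y &
      forall y, (forall i, g i y = 0) -> J (h y) <= b].

Lemma odd0 (V W : zmodType) (f : V -> W) : (forall w : W, w = - w -> w = 0) ->
  (forall v, f (- v) = - f v) -> f 0 = 0.
Proof. by move=> H fo; apply: H; rewrite -fo oppr0. Qed.

Lemma opp_self (V : normedModType R) (w : V) : w = - w -> w = 0.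
Proof.
move=> e; apply/eqP; have : w *+ 2 = 0 by rewrite mulr2n {1}e addNr.
by rewrite -scaler_nat => /eqP; rewrite scaler_eq0 pnatr_eq0.
Qed.

(** The k components of [Q \o h] and the j functions g have a common zero where |h| = rho; there J
    lies between alpha and b. *)
Lemma reachable_ge (j : nat) (b : R) : (k + j < a)%N -> reachable j b -> alpha <= b.
Proof.
move=> kja [h [g [[hc ho] gc go hi hb]]].
pose f (i : 'I_(k + j)) y := match fintype.split i with
  | inl i' => Q (h y) ord0 i' | inr i' => g i' y end.
have [||||||y [fy sy]] := @odd_zero_lt R _ a f (fun y => `|h y| - rho) r kja.
- move=> i; rewrite /f; case: (fintype.split i) => i'; last exact: gc.
  apply/continuousP_norm => x e e0.
  have /continuousP_norm /(_ x e e0)[d d0 Hd] : continuous (Q \o h).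
    by move=> y; apply: continuous_comp; [exact: hc|exact: Q_cont].
  exists d => // y /Hd; apply: le_lt_trans.
  by have := rV_le_norm (Q (h y) - Q (h x)) i'; rewrite !mxE.
- move=> i y; rewrite /f; case: (fintype.split i) => i'; last exact: go.
  by rewrite ho Q_odd mxE.
- exact: continuous_normB.
- by move=> y; rewrite ho normrN.
- by rewrite (odd0 (@opp_self Z) ho) normr0 sub0r oppr_lt0.
- by move=> y ry; rewrite subr_gt0 hi //; case: (iota_far ry).
have Qy : Q (h y) = 0.
  apply/rowP => i; have := fy (lshift j i); rewrite /f mxE.
  by have := unsplitK (inl i : 'I_k + 'I_j); rewrite /= => ->.
apply: le_trans (link Qy _) _; first by apply/eqP; rewrite -subr_eq0 sy.
apply: hb => i; have := fy (rshift k i); rewrite /f.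
by have := unsplitK (inr i : 'I_k + 'I_j); rewrite /= => ->.
Qed.

Lemma reachable0 : exists b, reachable 0 b.
Proof.
have [M HM] : exists M, forall y : 'rV[R]_a, `|y| <= r -> (J \o iota) y <= M.
  apply: compact_ub; last exact: compact_rV_ball.
  move=> y; apply: continuous_comp; [exact: iota_cont|exact: C1_continuous].
exists (Num.max M 0), iota, (fun _ _ => 0); split=> //.
- by move=> i; case: i.
- by move=> i; case: i.
- move=> y _; have [yr|yr] := leP `|y| r; first by rewrite le_max (HM _ yr).
  by rewrite le_max; have [-> _] := iota_far (ltW yr); rewrite orbT.
Qed.

Lemma separation_witness : exists2 L : R, 0 < L & (L%:E < separation (critical_set J))%E.
Proof.
move: J_sep; case: (separation _) => [s s0|_|//]; last by exists 1 => //; exact: ltry.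
by exists (s / 2); rewrite ?lte_fin in s0 *; lra.
Qed.

Definition zero_ball (j : nat) (g : 'I_j -> 'rV[R]_a -> R) :=
  [set y : 'rV[R]_a | `|y| <= r /\ forall i, g i y = 0].

Lemma zero_ball_compact j (g : 'I_j -> 'rV[R]_a -> R) :
  (forall i, continuous (g i)) -> compact (zero_ball g).
Proof.
move=> gc; have -> : zero_ball g = [set y | `|y| <= r] `&` \bigcap_i [set y | g i y = 0].
  by apply/seteqP; split=> [y [y1 y2]|y [y1 y2]]; split=> // i; [move=> _; exact: y2|exact: y2].
apply: compact_closedI; first exact: compact_rV_ball.
apply: closed_bigI => i _.
have -> : [set y | g i y = 0] = g i @^-1` [set t | t = 0] by [].
by apply: preimage_closed => [y _|]; [exact: gc|exact: closed_eq].
Qed.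

Lemma zero_ballN j (g : 'I_j -> 'rV[R]_a -> R) y :
  (forall i y, g i (- y) = - g i y) -> zero_ball g y -> zero_ball g (- y).
Proof. by move=> go [yr gy]; split; rewrite ?normrN // => i; rewrite go gy oppr0. Qed.

Lemma zero_ball0 j (g : 'I_j -> 'rV[R]_a -> R) :
  (forall i y, g i (- y) = - g i y) -> zero_ball g 0.
Proof.
move=> go; split; first by rewrite normr0 ltW.
by move=> i; apply: (odd0 _ (go i)) => w e; apply/eqP; lra.
Qed.

(** The deformation fixes points with [J <= 0], so it keeps the map equal to [iota] far away, where
    J is below [c - e] anyway. *)
Lemma reachable_descend (j : nat) (h0 : 'rV[R]_a -> Z) (g : 'I_j -> 'rV[R]_a -> R)
    (S : set Z) (c e tau tau' eta : R) :
  0 < e -> e < c -> 0 < tau -> 0 < tau' -> e *+ 2 < tau * eta ->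
  (forall u, S u -> S (- u)) ->
  (forall u, dist_set S u < eta -> `|J u - c| <= e ->
     ((tau *+ 2)%:E < dual_norm ('d J u))%E \/
     nbhs u S /\ (tau'%:E < dual_norm ('d J u))%E) ->
  continuous h0 -> (forall y, h0 (- y) = - h0 y) ->
  (forall i, continuous (g i)) -> (forall i y, g i (- y) = - g i y) ->
  (forall y, r <= `|y| -> h0 y = iota y) ->
  (forall y, zero_ball g y -> S (h0 y) /\ J (h0 y) <= c + e) ->
  reachable j (c - e).
Proof.
move=> e0 ec tau0 tau'0 e2 SN HS hc ho gc go hi hS.
have S0 : S !=set0 by exists (h0 0); case: (hS 0 (zero_ball0 go)).
have [h [h1c h1o h1 hA]] := strip_deformation J_C1 J_even e0 ec tau0 tau'0 e2 S0 SN HS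
  (zero_ball_compact gc) hc ho hS.
have hiota y : r <= `|y| -> h y = iota y.
  by move=> ry; rewrite h1 hi //; case: (iota_far ry).
exists h, g; split=> // y gy; have [yr|yr] := leP `|y| r; first exact: hA.
rewrite (hiota y (ltW yr)); have [Jy _] := iota_far (ltW yr); apply: le_trans Jy _.
by rewrite subr_ge0 ltW.
Qed.

Section Level.
Variables (j : nat) (c : R).
Hypothesis c_gt0 : 0 < c.
Hypothesis c_near : forall e, 0 < e -> reachable j (c + e).

(* The new odd function is nonzero near the clusters of almost critical points;
   on its zero set the slope is bounded below. *)
Lemma reachableS : exists2 e, 0 < e & reachable j.+1 (c - e).
Proof.
have [L L0 Lsep] := separation_witness.
(* Almost critical points near level c > 0 thus stay at distance at least d0 from 0, so a cluster of
   smaller diameter is disjoint from its opposite. *)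
have [d0 d00 Hd0] : exists2 d, 0 < d & forall u, `|u - 0| < d -> J u < c / 2.
  by apply: continuous_lt; [exact: C1_continuous|rewrite J0 divr_gt0].
pose q := Num.min d0 (L / 2).
have q0 : 0 < q by rewrite lt_min d00 divr_gt0.
have [e1 e10 He1] := almost_critical_clusters J_PS Lsep c q0.
pose e2 := Num.min e1 (c / 2).
have e20 : 0 < e2 by rewrite lt_min e10 divr_gt0.
pose N := almost_critical J c e2 e2.
have e21 : e2 <= e1 by rewrite ge_min lexx.
have [|||||chi [chic chio chiN]] := @odd_separation R Z N q L (L / 2) q0.
- by rewrite mulr2n [leRHS]splitr lerD // ge_min lexx orbT.
- by rewrite mulr2n -splitr.
- by move=> v; exact: almost_criticalN.
- move=> v [Jv _]; rewrite leNgt; apply/negP => vq.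
  have : J v < c / 2 by apply: Hd0; rewrite subr0 (lt_le_trans vq) // ge_min lexx.
  have : e2 <= c / 2 by rewrite ge_min lexx orbT.
  by move: Jv; rewrite ler_norml => /andP[]; lra.
- move=> v w Nv Nw.
  exact: (He1 v w (almost_criticalW e21 Nv) (almost_criticalW e21 Nw)).
(* With [tau = e2 / 2] and [eta = L / 2], this gives [2 e <= e2 * L / 8 < tau * eta]. *)
pose e := Num.min (e2 / 2) (e2 * L / 16).
have e2L : 0 < e2 * L / 16 by rewrite !mulr_gt0.
have e0 : 0 < e by rewrite lt_min divr_gt0.
have ee2 : e <= e2 / 2 by rewrite ge_min lexx.
have eL : e <= e2 * L / 16 by rewrite ge_min lexx orbT.
have e2c : e2 <= c / 2 by rewrite ge_min lexx orbT.
have [h0 [g [[hc ho] gc go hi hb]]] := c_near e0.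
pose g' (i : 'I_j.+1) := if unlift ord0 i is Some i' then g i' else chi \o h0.
exists e => //; pose A := zero_ball g'.
have g'c i : continuous (g' i).
  rewrite /g'; case: unlift => [i'|]; first exact: gc.
  by move=> y; apply: continuous_comp; [exact: hc|exact: chic].
have g'o i y : g' i (- y) = - g' i y.
  by rewrite /g'; case: unlift => [i'|]; rewrite ?go //= ho chio.
have A0 : [set h0 y | y in A] !=set0 by exists (h0 0), 0 => //; exact: zero_ball0.
apply: (@reachable_descend _ h0 g' [set h0 y | y in A] c e (e2 / 2) 1 (L / 2)) => //.
- lra.
- by rewrite divr_gt0.
- by rewrite mulr2n; lra.
- by move=> _ [y Ay <-]; exists (- y); [exact: zero_ballN|exact: ho].
- move=> u /(dist_set_lt A0)[_ [y Ay <-] uy] Ju; left.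
  (* With slope at most e2, u would belong to [N]; but [chi] vanishes at [h0 y], which is therefore
     at distance at least [L / 2] from [N]. *)
  rewrite ltNge; apply/negP => du.
  have Nu : N u by split; [lra|rewrite mulr2n -splitr in du].
  have : L / 2 <= `|h0 y - u|.
    apply: chiN => //; have [_ /(_ ord0)] := Ay; by rewrite /g' unlift_none.
  by rewrite distrC leNgt uy.
- move=> y Ay; split; first by exists y.
  apply: hb => i; have [_ /(_ (lift ord0 i))] := Ay; by rewrite /g' liftK.
Qed.

(* S adds to the compact set K the clusters met by K, which are left only by
   crossing a shell where the slope exceeds e1. *)
Lemma critical_level : (forall b, reachable j b -> c <= b) -> (J @` critical_set J) c.
Proof.
move=> c_min; apply: contrapT => nc.
have [L L0 Lsep] := separation_witness.
have [e0 e00 He0] := finite_gap J_fin nc.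
have L8 : 0 < L / 8 by rewrite divr_gt0.
have [e1 e10 He1] := almost_critical_clusters J_PS Lsep c L8.
pose N := almost_critical J c e1 e1.
have [e [e_gt0 ee0 ee1 ec eL]] : exists e : R, [/\ 0 < e, e <= e0, e <= e1, e < c &
    e *+ 2 < e1 / 2 * (L / 32)].
  have m0 : 0 < e1 / 2 * (L / 32) / 4 by rewrite !mulr_gt0.
  exists (Num.min (Num.min e0 e1) (Num.min (c / 2) (e1 / 2 * (L / 32) / 4))).
  set m := Num.min _ _; have [h1 h2 h3 h4] : [/\ m <= e0, m <= e1, m <= c / 2 &
      m <= e1 / 2 * (L / 32) / 4] by rewrite /m !ge_min !lexx !orbT.
  have mpos : 0 < m by rewrite /m !lt_min e00 e10 m0 divr_gt0.
  by clearbody m; split=> //; [lra|rewrite mulr2n; lra].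
have [h0 [g [[hc ho] gc go hi hb]]] := c_near e_gt0.
pose A := zero_ball g; pose K := [set h0 y | y in A].
have K0 : K !=set0 by exists (h0 0), 0 => //; exact: zero_ball0.
have KN u : K u -> K (- u).
  by move=> [y Ay <-]; exists (- y); [exact: zero_ballN|exact: ho].
have cK : compact K.
  by apply: continuous_compact; [exact: continuous_subspaceT|exact: zero_ball_compact].
(* The radius [3 L / 8] is less than [L / 2], and exceeds [L / 8 + L / 8], which bounds the distance
   to K of the points in the added balls. *)
have [||tau' tau'0 Htau] := @PS_tube R Z J J_C1 J_PS L Lsep K c e (3 * (L / 8)) cK K0 e_gt0.
- by rewrite mulr2n; lra.
- by move=> u Ku; apply: le_lt_trans ee0 _; apply: He0; exists u.
pose S := K `|` [set u | exists q, [/\ N q, dist_set K q < L / 8 & `|u - q| < L / 8]].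
suff : reachable j (c - e) by move=> /c_min; lra.
apply: (@reachable_descend _ h0 g S c e (e1 / 2) tau' (L / 32)) => //.
- by rewrite divr_gt0.
- move=> u [Ku|[q [Nq qK uq]]]; first by left; exact: KN.
  right; exists (- q); split; first exact: almost_criticalN.
    by rewrite dist_setN.
  by rewrite -opprD normrN.
- have S0 : S !=set0 by case: K0 => x Kx; exists x; left.
  move=> u /(dist_set_lt S0)[y Sy uy] Ju.
  have [slope|du] := ltP ((e1 / 2) *+ 2)%:E (dual_norm ('d J u)); [by left|right].
  have Nu : N u by split; [lra|rewrite mulr2n -splitr in du].
  have [q [Nq qK uq]] : exists q, [/\ N q, dist_set K q < L / 8 & `|u - q| < L / 8].
    case: Sy => [Ky|[q [Nq qK yq]]].
      exists u; split=> //; last by rewrite subrr normr0.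
      by apply: le_lt_trans (dist_set_le K0 _ Ky) _; lra.
    (* u is less than [L / 8 + L / 32] from q, hence not beyond L, so both lie in one cluster: the
       shell around the ball of q contains no almost critical point. *)
    exists q; split=> //; have [//|] := He1 u q Nu Nq.
    by have := ler_distD y u q; lra.
  split.
    apply/nbhs_normP; exists (L / 8 - `|u - q|); first by rewrite /= subr_gt0.
    move=> z /= uz; right; exists q; split=> //.
    by have := ler_distD u z q; rewrite distrC in uz; lra.
  apply: Htau => //; have := dist_set_lip K0 u q; lra.
- by move=> y Ay; split; [left; exists y|apply: hb => i; case: Ay].
Qed.

End Level.

Definition level (j : nat) : R := inf [set b | reachable j b].

Lemma levelP (j : nat) : (k + j < a)%N -> (exists b, reachable j b) ->
  [/\ 0 < level j, forall e, 0 < e -> reachable j (level j + e) &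
      forall b, reachable j b -> level j <= b].
Proof.
move=> kja [b0 rb0]; have ge b : reachable j b -> alpha <= b by exact: reachable_ge.
have li : has_inf [set b | reachable j b] by split; [exists b0|exists alpha].
split.
- by apply: lt_le_trans alpha_gt0 _; apply: lb_le_inf; [exists b0|].
- move=> e e0; have [b [h [g [? ? ? ? hb]]] ble] := inf_adherent e0 li.
  exists h, g; split=> // y gy; apply: le_trans (hb y gy) _; exact: ltW.
- by move=> b rb; apply: ge_inf => //; case: li.
Qed.

(** Nonemptiness is needed for [level] to be a genuine infimum; [reachableS] supplies it from one
    index to the next. *)
Lemma reachable_ex (j : nat) : (k + j < a)%N -> exists b, reachable j b.
Proof.
elim: j => [|j IH] kja; first exact: reachable0.
have kja' : (k + j < a)%N by rewrite (leq_ltn_trans _ kja) // leq_add2l.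
have [c0 cn _] := levelP kja' (IH kja').
by have [e _ re] := reachableS c0 cn; exists (level j - e).
Qed.

Lemma level_critical (j : nat) : (k + j < a)%N -> (J @` critical_set J) (level j).
Proof.
move=> kja; have [c0 cn cm] := levelP kja (reachable_ex kja).
exact: (critical_level c0 cn cm).
Qed.

Lemma level_decreasing (j : nat) : (k + j.+1 < a)%N -> level j.+1 < level j.
Proof.
move=> kja; have kja' : (k + j < a)%N by rewrite (leq_ltn_trans _ kja) // leq_add2l.
have [c0 cn _] := levelP kja' (reachable_ex kja').
have [e e0 re] := reachableS c0 cn; have [_ _ cm] := levelP kja (reachable_ex kja).
by apply: le_lt_trans (cm _ re) _; rewrite ltrBlDr ltrDl.
Qed.

Lemma card_critical_values : (`I_(a - k) #<= J @` critical_set J)%card.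
Proof.
have lt_level j i : (k + j < a)%N -> (i < j)%N -> level j < level i.
  elim: j => // j IH kja; rewrite ltnS leq_eqVlt => /orP[/eqP ->|ij].
    exact: level_decreasing.
  apply: lt_trans (level_decreasing kja) (IH _ ij).
  by rewrite (leq_ltn_trans _ kja) // leq_add2l.
have inj : {in `I_(a - k) &, injective level}.
  move=> i j /set_mem /= ia /set_mem /= ja e.
  have [ij|ji|//] := ltngtP i j.
    have := @lt_level j i _ ij; rewrite e ltxx => H.
    by have : (k + j < a)%N by [lia]; move/H.
  have := @lt_level i j _ ji; rewrite e ltxx => H.
  by have : (k + i < a)%N by [lia]; move/H.
rewrite -(card_le_eql (inj_card_eq inj)).
apply: subset_card_le => _ [j /= ja <-]; apply: level_critical; lia.
Qed.

End Minimax.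

(** * From the hypotheses to the minimax setting *)

Lemma separation_ge (R : realType) (Z : normedModType R) (A : set Z) (e : R) :
  (forall u v, A u -> A v -> u <> v -> e <= `|u - v|) -> (e%:E <= separation A)%E.
Proof.
move=> H; apply: le_ereal_inf_tmp => _ [u [v [Au Av uv ->]]].
by rewrite lee_fin; exact: H.
Qed.

Lemma separation_finite_gt0 (R : realType) (Z : normedModType R) (A : set Z) :
  finite_set A -> (0 < separation A)%E.
Proof.
move=> fA; pose D := [set `|p.1 - p.2| | p in (A `*` A) `&` [set p | p.1 <> p.2]].
have fD : finite_set D.
  by apply/finite_image/finite_setIl; exact: finite_setX.
have [|e e0 eD] := finite_gap (c := 0) fD.
  by move=> [[u v] /= [_ uv]] /eqP; rewrite normr_eq0 subr_eq0 => /eqP.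
apply: (@lt_le_trans _ _ e%:E); first by rewrite lte_fin.
apply: separation_ge => u v Au Av uv; apply: ltW.
by have := eD `|u - v|; rewrite subr0 normr_id; apply; exists (u, v).
Qed.

Lemma lincomb_of_fun (R : realType) (Z : normedModType R) n (b : 'I_n -> Z) (c : 'I_n -> R) :
  \sum_(i < n) c i *: b i = lincomb b (\row_i c i).
Proof. by apply: eq_bigr => i _; rewrite mxE. Qed.

Lemma has_dimP (R : realType) (Z : normedModType R) (A : set Z) n : has_dim A n ->
  exists b : 'I_n -> Z, [/\ forall c, lincomb b c = 0 -> c = 0,
    forall c, A (lincomb b c) & forall u, A u -> exists c, u = lincomb b c].
Proof.
move=> [b [indep ->]]; exists b; split.
- move=> c /indep H; apply/rowP => i; by rewrite mxE H.
- by move=> c; exists (fun i => c ord0 i).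
- by move=> _ [c _ <-]; exists (\row_i c i); rewrite lincomb_of_fun.
Qed.

Section CriticalValues.
Context {R : realType} (Z : completeNormedModType R).
Variables (Zpos Zneg : set Z) (J : Z -> R).
Hypothesis G1_sum : direct_sum Zpos Zneg.
Hypothesis G1_neg : finite_dim Zneg.
Hypothesis G2_C1 : is_C1 J.
Hypothesis G2_even : forall u, J (- u) = J u.
Hypothesis G2_zero : J 0 = 0.
Hypothesis G2_sphere : exists rho : R, 0 < rho /\
  (0 < ereal_inf [set (J v)%:E | v in [set v | Zpos v /\ (`|v| = rho)%R]])%E.
Hypothesis G4 : PS_attracting J.

Lemma infinite_critical_values (W : set Z) (d : nat) :
  W `<=` Zpos -> has_dim W d ->
  (exists r : R, forall u, sum_set Zneg W u -> r <= `|u| -> J u <= 0) ->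
  (0 < separation (critical_set J))%E -> finite_set (J @` critical_set J) ->
  (`I_d #<= J @` critical_set J)%card.
Proof.
move=> WZ /has_dimP[bW [bW_free bW_in _]] [r1 Jr1] Ksep Kfin.
have [sZp sZn cZp cZn [ZpZn ZpIZn]] := G1_sum.
have [k /has_dimP[bN [bN_free bN_in bN_span]]] := G1_neg.
have [rho [rho0 Jrho]] := G2_sphere.
(* An infinite infimum bounds J below by any real; 1 is taken. *)
have [alpha alpha0 Jalpha] : exists2 alpha : R, 0 < alpha &
    forall v, Zpos v -> `|v| = rho -> alpha <= J v.
  have lb (x : R) : (x%:E <= ereal_inf [set (J v)%:E | v in [set v | Zpos v /\ (`|v| = rho)%R]])%E ->
      forall v, Zpos v -> `|v| = rho -> x <= J v.
    move=> xl v Zv vr; rewrite -lee_fin; apply: le_trans xl _.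
    by apply: ereal_inf_lbound; exists v.
  move: Jrho lb; case: (ereal_inf _) => [x x0 lb|_ lb|//].
    by exists x; [rewrite lte_fin in x0|exact: lb].
  by exists 1 => //; apply: lb; rewrite leey.
have Zp_cap c : Zpos (lincomb bN c) -> c = 0.
  move=> Zc; apply: bN_free; have : (Zpos `&` Zneg) (lincomb bN c) by split.
  by rewrite ZpIZn.
have [Q [Qc Qo QZ]] : exists Q : Z -> 'rV[R]_k, [/\ continuous Q,
    forall u, Q (- u) = - Q u & forall u, Q u = 0 -> Zpos u].
  apply: (projection_coordinates sZp cZp Zp_cap) => u.
  have : [set: Z] u by []; rewrite -ZpZn => -[x Zx [y /bN_span[c ->] <-]].
  by exists c => //; rewrite addrK.
(* A basis of the sum of [Zneg] and [W], of dimension k + d; this leaves (k + d) - k = d levels. *)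
pose b (i : 'I_(k + d)) : Z := match fintype.split i with inl i' => bN i' | inr i' => bW i' end.
have bE c : lincomb b c = lincomb bN (lsubmx c) + lincomb bW (rsubmx c).
  rewrite /lincomb big_split_ord; congr (_ + _); apply: eq_bigr => i _; rewrite mxE /b.
    by have := unsplitK (inl i : 'I_k + 'I_d); rewrite /= => ->.
  by have := unsplitK (inr i : 'I_k + 'I_d); rewrite /= => ->.
have b_free c : [set 0] (lincomb b c) -> c = 0.
  rewrite /= bE => /eqP; rewrite addr_eq0 => /eqP e.
  have l0 : lsubmx c = 0.
    apply: Zp_cap; rewrite e -lincombN; apply: WZ; exact: bW_in.
  have r0 : rsubmx c = 0.
    by apply: bW_free; apply/eqP; rewrite -oppr_eq0 -e l0 -(scale0r 0) lincombZ scale0r.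
  by rewrite -[c]hsubmxK l0 r0 row_mx0.
have [m m0 Hm] := closed_complement_bound (@subspace0 _ Z)
  (compact_closed (@norm_hausdorff _ Z) (@compact_set1 _ (0 : Z))) b_free.
(* Coordinates of norm at least r give vectors of norm at least |r1| + rho + 1, beyond both r1 and
   rho. *)
pose r := (`|r1| + rho + 1) / m.
have r0 : 0 < r by rewrite divr_gt0 // ltr_wpDl // addr_ge0 // ltW.
have far y : r <= `|y| -> J (lincomb b y) <= 0 /\ rho < `|lincomb b y|.
  rewrite ler_pdivrMr // mulrC => ry.
  have := Hm 0 y erefl; rewrite add0r => my.
  have n1 := normr_ge0 r1; have n2 := ler_norm r1; split; last by lra.
  apply: Jr1; last by lra.
  by rewrite bE; exists (lincomb bN (lsubmx y)) => //; exists (lincomb bW (rsubmx y)).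
have link u : Q u = 0 -> `|u| = rho -> alpha <= J u by move=> /QZ; exact: Jalpha.
have := card_critical_values G2_C1 G2_even G2_zero G4 Ksep Kfin Qc Qo
  (@lincomb_continuous _ _ _ b) (@lincombN _ _ _ b) rho0 alpha0 link r0 far.
by rewrite addKn.
Qed.

End CriticalValues.

Theorem theorem5 (R : realType) (Z : completeNormedModType R)
  (Zpos Zneg : set Z) (J : Z -> R)
  (G1_sum : direct_sum Zpos Zneg)
  (G1_neg : finite_dim Zneg)
  (G1_pos : ~ finite_dim Zpos)
  (G2_C1 : is_C1 J)
  (G2_even : forall u, J (- u) = J u)
  (G2_zero : J 0 = 0)
  (G2_sphere : exists rho : R, 0 < rho /\
    (0 < ereal_inf [set (J v)%:E | v in [set v | Zpos v /\ (`|v| = rho)%R]])%E)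
  (G3 : exists (Zs : nat -> set Z) (d : nat -> nat),
    [/\ forall m, Zs m `<=` Zpos,
        forall m, has_dim (Zs m) (d m),
        forall m (M : R), exists r : R, forall u,
          sum_set Zneg (Zs m) u -> r <= `|u| -> J u <= M,
        nondecreasing_seq d &
        d @ \oo --> \oo])
  (G4 : PS_attracting J) :
  (forall (I : Type) (Ks : I -> set Z),
     K_decomposition J Ks -> infinite_set [set: I]) /\
  infinite_set (critical_pairs J).
Proof.
(* Both assertions reduce to this: a test space of dimension larger than the number of critical
   values gives too many of them. *)
have core : (0 < separation (critical_set J))%E -> finite_set (J @` critical_set J) -> False.
  move=> Ksep Kfin; have [Zs [d [ZsZ Zd Jd _ dy]]] := G3.
  have /finite_setP[n Kn] := Kfin.
  have [m _ /(_ m (leqnn m)) dm] : \forall m \near \oo, (n.+1 <= d m)%N.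
    by move/cvgnyPge : dy; apply.
  have := infinite_critical_values G1_sum G1_neg G2_C1 G2_even G2_zero G2_sphere G4
    (ZsZ m) (Zd m) (Jd m 0) Ksep Kfin.
  by rewrite (card_le_eqr Kn) card_le_II leqNgt dm.
split=> [I Ks [KE KP] fI|fP].
  apply: core.
    (* Any two critical points lie in the union of two pieces, so the least of finitely many
       separations bounds them all; an infinite separation is replaced by 1. *)
    have /choice[f fP] : forall p : I * I, exists x : R, 0 < x /\
        (x%:E <= separation (Ks p.1 `|` Ks p.2))%E.
      move=> [i j] /=; have [_ + _] := KP i j.
      case: (separation _) => [x x0|_|//]; last by exists 1; rewrite leey.
      by exists x; rewrite lte_fin in x0.
    have [|e e0 eP] := finite_gap (c := 0) (finite_image f (finite_setX fI fI)).
      by move=> [p _ fp]; have [] := fP p; rewrite fp ltxx.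
    apply: (@lt_le_trans _ _ e%:E); first by rewrite lte_fin.
    apply: separation_ge => u v; rewrite KE => -[i _ ui] [j _ vj] uv.
    have [f0 fs] := fP (i, j); have := eP (f (i, j)); rewrite subr0 gtr0_norm // => ef.
    apply: le_trans (ltW (ef _)) _; first by exists (i, j).
    rewrite -lee_fin; apply: le_trans fs _; apply: ereal_inf_lbound.
    by exists u, v; split=> //; [left|right].
  rewrite KE image_bigcup; apply: bigcup_finite => // i _.
  by have [] := KP i i.
have fK : finite_set (critical_set J).
  apply: (@sub_finite_set _ _ ([set 0] `|` \bigcup_(P in critical_pairs J) P)).
    move=> u Ku; have [->|/eqP u0] := eqVneq u 0; first by left.
    by right; exists [set u; - u]; [exists u|left].
  rewrite finite_setU; split; first exact: finite_set1.
  apply: bigcup_finite => // _ [u _ <-].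
  by rewrite finite_setU; split; exact: finite_set1.
by apply: core; [exact: separation_finite_gt0|exact: finite_image].
Qed.
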